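(* Let $S\subseteq M_n$ be a set of formal monomials such that $\mathscr{G}$ restricted to $S$ is a bijection from $S$ onto $\overline{\mathcal{G}}_n$. Then the images of the elements of $S$ in $\mathscr{Lie}_2(n)$ form a basis of $\mathscr{Lie}_2(n)$.
   Context: Let $R$ be a commutative ring with unit, $X=\{x_1<\dots<x_n\}$. $\mathscr{Lie}_2(n)$ is the multilinear part (span of bracket monomials containing each $x_i$ exactly once) of the free $R$-algebra on $X$ with two bilinear brackets $[\cdot,\cdot]$, $\langle\cdot,\cdot\rangle$ subject only to: $[x,y]+[y,x]=0$; $\langle x,y\rangle+\langle y,x\rangle=0$; $[x,[y,z]]+[y,[z,x]]+[z,[x,y]]=0$; $\langle x,\langle y,z\rangle\rangle+\langle y,\langle z,x\rangle\rangle+\langle z,\langle x,y\rangle\rangle=0$; $[x,\langle y,z\rangle]+[y,\langle z,x\rangle]+[z,\langle x,y\rangle]+\langle x,[y,z]\rangle+\langle y,[z,x]\rangle+\langle z,[x,y]\rangle=0$. $M_n$ is the set of formal complete bracketings of the letters of $X$ (each used once) with these two operations. Graphical root: $\operatorname{gr}(x)=x$, $\operatorname{gr}([m_1,m_2])=\min(\operatorname{gr}(m_1),\operatorname{gr}(m_2))$, $\operatorname{gr}(\langle m_1,m_2\rangle)=\max(\operatorname{gr}(m_1),\operatorname{gr}(m_2))$. The two-colored graph $\mathscr{G}(m)$: $\mathscr{G}(x)=x$; for $m=\{m_1,m_2\}$, $\mathscr{G}(m)$ is the union of $\mathscr{G}(m_1)$, $\mathscr{G}(m_2)$ and an edge $\{\operatorname{gr}(m_1),\operatorname{gr}(m_2)\}$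 colored red if $\{\cdot,\cdot\}=[\cdot,\cdot]$ and blue otherwise. $\overline{\mathcal{G}}_n$ is the set of trees on vertex set $X$ with edges colored red or blue avoiding: (1) $i<j<k$ with $\{i,k\},\{j,k\}$ both red; (2) $i<j<k$ with $\{i,j\},\{i,k\}$ both blue; (3) $i<j<k$ with $\{i,j\}$ red and $\{j,k\}$ blue. *)

(* Defs.v *)
From HB Require Import structures.
From mathcomp Require Import all_boot all_order all_algebra.
From mathcomp Require Import boolp classical_sets functions.

Set Implicit Arguments.
Unset Strict Implicit.
Unset Printing Implicit Defensive.

Import GRing.Theory.
Local Open Scope ring_scope.

(* The colour doubles as the name of the bracket: [x, y] is the Red bracket
   and <x, y> the Blue one. *)
Variant color := Red | Blue.

Definition bool_of_color (c : color) : bool := if c is Red then true else false.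
Definition color_of_bool (b : bool) : color := if b then Red else Blue.

Lemma bool_of_colorK : cancel bool_of_color color_of_bool.
Proof. by case. Qed.

HB.instance Definition _ := Finite.copy color (can_type bool_of_colorK).

Definition lie2_axioms (R : comPzRingType) (L : lmodType R)
    (br : color -> L -> L -> L) : Prop :=
  [/\ (forall c a x y z, br c (a *: x + y) z = a *: br c x z + br c y z) /\
      (forall c a x y z, br c z (a *: x + y) = a *: br c z x + br c z y),
      forall c x y, br c x y + br c y x = 0,
      forall c x y z,
        br c x (br c y z) + br c y (br c z x) + br c z (br c x y) = 0
    & forall x y z,
        br Red x (br Blue y z) + br Red y (br Blue z x) + br Red z (br Blue x y)
      + br Blue x (br Red y z) + br Blue y (br Red z x) + br Blue z (br Red x y)
      = 0].

(** The free two-bracket algebra on x_0, ..., x_(n-1): terms modulo the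
    congruence generated by the R-module laws, bilinearity and the bracket
    identities. [lie2_universal] below is its universal property. *)

Inductive term (R : Type) (n : nat) : Type :=
| TVar of 'I_n
| TZero
| TAdd of term R n & term R n
| TScale of R & term R n
| TBr of color & term R n & term R n.

Arguments TVar {R n}.
Arguments TZero {R n}.

HB.instance Definition _ R n := gen_eqMixin (term R n).
HB.instance Definition _ R n := gen_choiceMixin (term R n).

Inductive term_eq (R : comPzRingType) (n : nat) : term R n -> term R n -> Prop :=
| teq_refl t : term_eq t t
| teq_sym s t : term_eq s t -> term_eq t s
| teq_trans s t u : term_eq s t -> term_eq t u -> term_eq s u
| teq_add s s' t t' :
    term_eq s s' -> term_eq t t' -> term_eq (TAdd s t) (TAdd s' t')
| teq_scale a t t' : term_eq t t' -> term_eq (TScale a t) (TScale a t')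
| teq_br c s s' t t' :
    term_eq s s' -> term_eq t t' -> term_eq (TBr c s t) (TBr c s' t')
| teq_addA s t u : term_eq (TAdd s (TAdd t u)) (TAdd (TAdd s t) u)
| teq_addC s t : term_eq (TAdd s t) (TAdd t s)
| teq_add0 t : term_eq (TAdd TZero t) t
| teq_addN t : term_eq (TAdd (TScale (-1) t) t) TZero
| teq_scaleA a b t : term_eq (TScale a (TScale b t)) (TScale (a * b) t)
| teq_scale1 t : term_eq (TScale 1 t) t
| teq_scaleDr a s t :
    term_eq (TScale a (TAdd s t)) (TAdd (TScale a s) (TScale a t))
| teq_scaleDl a b t :
    term_eq (TScale (a + b) t) (TAdd (TScale a t) (TScale b t))
| teq_brDl c s t u : term_eq (TBr c (TAdd s t) u) (TAdd (TBr c s u) (TBr c t u))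
| teq_brZl c a s t : term_eq (TBr c (TScale a s) t) (TScale a (TBr c s t))
| teq_brDr c s t u : term_eq (TBr c u (TAdd s t)) (TAdd (TBr c u s) (TBr c u t))
| teq_brZr c a s t : term_eq (TBr c t (TScale a s)) (TScale a (TBr c t s))
| teq_anti c s t : term_eq (TAdd (TBr c s t) (TBr c t s)) TZero
| teq_jacobi c s t u :
    term_eq (TAdd (TAdd (TBr c s (TBr c t u)) (TBr c t (TBr c u s)))
                  (TBr c u (TBr c s t))) TZero
| teq_mixed s t u :
    term_eq (TAdd (TAdd (TAdd (TAdd (TAdd
               (TBr Red s (TBr Blue t u)) (TBr Red t (TBr Blue u s)))
               (TBr Red u (TBr Blue s t)))
               (TBr Blue s (TBr Red t u))) (TBr Blue t (TBr Red u s)))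
               (TBr Blue u (TBr Red s t))) TZero.

Definition term_eqb (R : comPzRingType) (n : nat) : rel (term R n) :=
  fun s t => `[< term_eq s t >].

Lemma term_eqb_refl (R : comPzRingType) n : reflexive (@term_eqb R n).
Proof. by move=> t; apply/asboolP; exact: teq_refl. Qed.

Lemma term_eqb_sym (R : comPzRingType) n : symmetric (@term_eqb R n).
Proof. by move=> s t; apply/asboolP/asboolP; exact: teq_sym. Qed.

Lemma term_eqb_trans (R : comPzRingType) n : transitive (@term_eqb R n).
Proof.
by move=> t s u /asboolP st /asboolP tu; apply/asboolP; exact: teq_trans tu.
Qed.

Definition term_equiv (R : comPzRingType) (n : nat) : equiv_rel (term R n) :=
  EquivRel (@term_eqb R n)
    (@term_eqb_refl R n) (@term_eqb_sym R n) (@term_eqb_trans R n).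

Definition lie2 (R : comPzRingType) (n : nat) : Type :=
  {eq_quot (term_equiv R n)}%qT.

HB.instance Definition _ (R : comPzRingType) n := Choice.on (lie2 R n).
HB.instance Definition _ (R : comPzRingType) n : EqQuotient _ (term_equiv R n) (lie2 R n) :=
  EqQuotient.on (lie2 R n).

Definition lie2_class (R : comPzRingType) n (t : term R n) : lie2 R n := (\pi_(lie2 R n) t)%qT.

Lemma lie2_classP (R : comPzRingType) n (s t : term R n) :
  lie2_class s = lie2_class t <-> term_eq s t.
Proof.
rewrite /lie2_class; split=> [/eqmodP/asboolP //|st].
by apply/eqmodP/asboolP.
Qed.

Lemma lie2_reprK (R : comPzRingType) n (x : lie2 R n) : lie2_class (repr x) = x.
Proof. exact: reprK. Qed.

Lemma lie2_repr_class (R : comPzRingType) n (t : term R n) : term_eq (repr (lie2_class t)) t.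
Proof. by apply/lie2_classP; rewrite lie2_reprK. Qed.

Lemma lie2_ind (R : comPzRingType) n (P : lie2 R n -> Prop) :
  (forall t, P (lie2_class t)) -> forall x, P x.
Proof. by move=> Pt x; rewrite -(lie2_reprK x). Qed.

Definition lie2_gen (R : comPzRingType) n (i : 'I_n) : lie2 R n :=
  lie2_class (TVar i).
Definition lie2_zero (R : comPzRingType) n : lie2 R n := lie2_class TZero.
Definition lie2_add (R : comPzRingType) n (x y : lie2 R n) : lie2 R n :=
  lie2_class (TAdd (repr x) (repr y)).
Definition lie2_scale (R : comPzRingType) n (a : R) (x : lie2 R n) : lie2 R n :=
  lie2_class (TScale a (repr x)).
Definition lie2_opp (R : comPzRingType) n (x : lie2 R n) : lie2 R n := lie2_scale (-1) x.
Definition lie2_br (R : comPzRingType) n (c : color) (x y : lie2 R n) : lie2 R n :=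
  lie2_class (TBr c (repr x) (repr y)).

Lemma lie2_addE (R : comPzRingType) n (s t : term R n) :
  lie2_add (lie2_class s) (lie2_class t) = lie2_class (TAdd s t).
Proof. by apply/lie2_classP/teq_add; exact: lie2_repr_class. Qed.

Lemma lie2_scaleE (R : comPzRingType) n a (t : term R n) :
  lie2_scale a (lie2_class t) = lie2_class (TScale a t).
Proof. by apply/lie2_classP/teq_scale; exact: lie2_repr_class. Qed.

Lemma lie2_brE (R : comPzRingType) n c (s t : term R n) :
  lie2_br c (lie2_class s) (lie2_class t) = lie2_class (TBr c s t).
Proof. by apply/lie2_classP/teq_br; exact: lie2_repr_class. Qed.

Lemma lie2_addA (R : comPzRingType) n : associative (@lie2_add R n).
Proof.
elim/lie2_ind=> s; elim/lie2_ind=> t; elim/lie2_ind=> u.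
by rewrite !lie2_addE; apply/lie2_classP; constructor.
Qed.

Lemma lie2_addC (R : comPzRingType) n : commutative (@lie2_add R n).
Proof.
elim/lie2_ind=> s; elim/lie2_ind=> t.
by rewrite !lie2_addE; apply/lie2_classP; apply: teq_addC.
Qed.

Lemma lie2_add0 (R : comPzRingType) n : left_id (@lie2_zero R n) (@lie2_add R n).
Proof.
by elim/lie2_ind=> t; rewrite lie2_addE; apply/lie2_classP; apply: teq_add0.
Qed.

Lemma lie2_addN (R : comPzRingType) n :
  left_inverse (@lie2_zero R n) (@lie2_opp R n) (@lie2_add R n).
Proof.
elim/lie2_ind=> t; rewrite /lie2_opp lie2_scaleE lie2_addE.
by apply/lie2_classP; apply: teq_addN.
Qed.

HB.instance Definition _ (R : comPzRingType) n := GRing.isZmodule.Build (lie2 R n)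
  (@lie2_addA R n) (@lie2_addC R n) (@lie2_add0 R n) (@lie2_addN R n).

Lemma lie2_scaleA (R : comPzRingType) n (a b : R) (x : lie2 R n) :
  lie2_scale a (lie2_scale b x) = lie2_scale (a * b) x.
Proof.
elim/lie2_ind: x => t; rewrite !lie2_scaleE.
by apply/lie2_classP; apply: teq_scaleA.
Qed.

Lemma lie2_scale1 (R : comPzRingType) n : left_id 1 (@lie2_scale R n).
Proof.
by elim/lie2_ind=> t; rewrite lie2_scaleE; apply/lie2_classP; apply: teq_scale1.
Qed.

Lemma lie2_scaleDr (R : comPzRingType) n : right_distributive (@lie2_scale R n) +%R.
Proof.
move=> a; elim/lie2_ind=> s; elim/lie2_ind=> t.
rewrite /GRing.add /= lie2_addE !lie2_scaleE lie2_addE.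
by apply/lie2_classP; apply: teq_scaleDr.
Qed.

Lemma lie2_scaleDl (R : comPzRingType) n (x : lie2 R n) :
  {morph (@lie2_scale R n)^~ x : a b / a + b}.
Proof.
move=> a b; elim/lie2_ind: x => t.
rewrite {2}/GRing.add /= !lie2_scaleE lie2_addE.
by apply/lie2_classP; apply: teq_scaleDl.
Qed.

HB.instance Definition _ (R : comPzRingType) n := GRing.Zmodule_isLmodule.Build R (lie2 R n)
  (@lie2_scaleA R n) (@lie2_scale1 R n) (@lie2_scaleDr R n) (@lie2_scaleDl R n).

Lemma lie2_classD (R : comPzRingType) n (s t : term R n) :
  lie2_class (TAdd s t) = lie2_class s + lie2_class t.
Proof. by rewrite -lie2_addE. Qed.

Lemma lie2_classZ (R : comPzRingType) n a (t : term R n) :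
  lie2_class (TScale a t) = a *: lie2_class t.
Proof. by rewrite -lie2_scaleE. Qed.

Lemma lie2_classB (R : comPzRingType) n c (s t : term R n) :
  lie2_class (TBr c s t) = lie2_br c (lie2_class s) (lie2_class t).
Proof. by rewrite lie2_brE. Qed.

Lemma lie2_class0 (R : comPzRingType) n : lie2_class (@TZero R n) = 0.
Proof. by []. Qed.

Definition lie2_classE := (lie2_classD, lie2_classZ, lie2_classB, lie2_class0).

Lemma lie2_satisfies_axioms (R : comPzRingType) n : lie2_axioms (@lie2_br R n).
Proof.
split; first split.
- move=> c a; elim/lie2_ind=> s; elim/lie2_ind=> t; elim/lie2_ind=> u.
  have /lie2_classP := teq_brDl c (TScale a s) t u.
  have /lie2_classP := teq_brZl c a s u.
  by rewrite !lie2_classE => -> ->.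
- move=> c a; elim/lie2_ind=> s; elim/lie2_ind=> t; elim/lie2_ind=> u.
  have /lie2_classP := teq_brDr c (TScale a s) t u.
  have /lie2_classP := teq_brZr c a s u.
  by rewrite !lie2_classE => -> ->.
- move=> c; elim/lie2_ind=> s; elim/lie2_ind=> t.
  by have /lie2_classP := teq_anti c s t; rewrite !lie2_classE.
- move=> c; elim/lie2_ind=> s; elim/lie2_ind=> t; elim/lie2_ind=> u.
  by have /lie2_classP := teq_jacobi c s t u; rewrite !lie2_classE.
- elim/lie2_ind=> s; elim/lie2_ind=> t; elim/lie2_ind=> u.
  by have /lie2_classP := teq_mixed s t u; rewrite !lie2_classE.
Qed.

Fixpoint term_eval (R : comPzRingType) (n : nat) (L : lmodType R)
    (br : color -> L -> L -> L) (x : 'I_n -> L) (t : term R n) : L :=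
  match t with
  | TVar i => x i
  | TZero => 0
  | TAdd s t => term_eval br x s + term_eval br x t
  | TScale a t => a *: term_eval br x t
  | TBr c s t => br c (term_eval br x s) (term_eval br x t)
  end.

Lemma term_eval_eq (R : comPzRingType) n (L : lmodType R)
    (br : color -> L -> L -> L) (x : 'I_n -> L) (s t : term R n) :
  lie2_axioms br -> term_eq s t -> term_eval br x s = term_eval br x t.
Proof.
case=> [[brl brr] anti jac mix].
have brDl c u v w : br c (u + v) w = br c u w + br c v w.
  by rewrite -[u]scale1r brl !scale1r.
have brDr c u v w : br c w (u + v) = br c w u + br c w v.
  by rewrite -[u]scale1r brr !scale1r.
have br0l c w : br c 0 w = 0.
  by apply: (addrI (br c 0 w)); rewrite -brDl !addr0.
have br0r c w : br c w 0 = 0.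
  by apply: (addrI (br c w 0)); rewrite -brDr !addr0.
elim=> //=.
- by move=> ? ? ? _ -> _ ->.
- by move=> ? ? ? ? _ -> _ ->.
- by move=> ? ? ? _ ->.
- by move=> ? ? ? ? ? _ -> _ ->.
- by move=> *; rewrite addrA.
- by move=> *; rewrite addrC.
- by move=> *; rewrite add0r.
- by move=> *; rewrite scaleN1r addNr.
- by move=> *; rewrite scalerA.
- by move=> *; rewrite scale1r.
- by move=> *; rewrite scalerDr.
- by move=> *; rewrite scalerDl.
- by move=> c a u v; rewrite -[a *: _]addr0 brl br0l addr0.
- by move=> c a u v; rewrite -[a *: _]addr0 brr br0r addr0.
Qed.

Lemma lie2_universal (R : comPzRingType) n (L : lmodType R)
    (br : color -> L -> L -> L) (x : 'I_n -> L) :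
  lie2_axioms br ->
  exists! f : lie2 R n -> L,
    [/\ forall a u v, f (a *: u + v) = a *: f u + f v,
        forall c u v, f (lie2_br c u v) = br c (f u) (f v)
      & forall i, f (lie2_gen R i) = x i].
Proof.
move=> ax; pose f (u : lie2 R n) := term_eval br x (repr u).
have fE t : f (lie2_class t) = term_eval br x t.
  by apply: term_eval_eq => //; apply: lie2_repr_class.
exists f; split.
  split=> [a||i]; last exact: fE.
  - elim/lie2_ind=> s; elim/lie2_ind=> t.
    by rewrite -lie2_classZ -lie2_classD !fE.
  - by move=> c; elim/lie2_ind=> s; elim/lie2_ind=> t; rewrite -lie2_classB !fE.
move=> g [glin gbr gx]; apply/funext; elim/lie2_ind=> t; rewrite fE.
have gD u v : g (u + v) = g u + g v by rewrite -[u]scale1r glin !scale1r.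
have g0 : g 0 = 0 by apply: (addrI (g 0)); rewrite -gD !addr0.
elim: t => [i||s IHs t IHt|a t IHt|c s IHs t IHt] /=.
- by rewrite -gx.
- by rewrite lie2_class0 g0.
- by rewrite lie2_classD gD IHs IHt.
- by rewrite lie2_classZ -[_ *: lie2_class _]addr0 glin g0 addr0 IHt.
- by rewrite lie2_classB gbr IHs IHt.
Qed.

Inductive monomial (n : nat) : Type :=
| Leaf of 'I_n
| Br of color & monomial n & monomial n.

HB.instance Definition _ n := gen_eqMixin (monomial n).
HB.instance Definition _ n := gen_choiceMixin (monomial n).

Fixpoint letters n (m : monomial n) : seq 'I_n :=
  match m with
  | Leaf i => [:: i]
  | Br _ m1 m2 => letters m1 ++ letters m2
  end.

Definition multilinear_monomials (n : nat) : set (monomial n) :=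
  [set m | perm_eq (letters m) (enum 'I_n)]%classic.
Arguments multilinear_monomials : clear implicits.

Fixpoint monomial_image (R : comPzRingType) n (m : monomial n) : lie2 R n :=
  match m with
  | Leaf i => lie2_gen R i
  | Br c m1 m2 => lie2_br c (monomial_image R m1) (monomial_image R m2)
  end.

Fixpoint gr n (m : monomial n) : 'I_n :=
  match m with
  | Leaf i => i
  | Br Red m1 m2 => Order.min (gr m1) (gr m2)
  | Br Blue m1 m2 => Order.max (gr m1) (gr m2)
  end.

(* A two-coloured graph on the vertex set 'I_n is given by its set of coloured
   edges, an edge being an unordered pair of vertices. *)
Notation cgraph n := {set {set 'I_n} * color}.

Fixpoint graph n (m : monomial n) : cgraph n :=
  match m with
  | Leaf _ => finset.set0
  | Br c m1 m2 =>
      (graph m1 :|: graph m2 :|: [set ([set gr m1; gr m2], c)])%SET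
  end.

Definition has_edge n (g : cgraph n) (c : color) (i j : 'I_n) : bool :=
  (([set i; j]%SET : {set 'I_n}), c) \in g.

Definition adjacent n (g : cgraph n) : rel 'I_n :=
  fun i j => has_edge g Red i j || has_edge g Blue i j.

(* The first two clauses say that the uncoloured graph is simple and that each
   edge has only one colour; the last two, that it is connected and acyclic. *)
Definition colored_tree n (g : cgraph n) : Prop :=
  [/\ forall e c, (e, c) \in g -> #|e| = 2%N,
      forall e c c', (e, c) \in g -> (e, c') \in g -> c = c',
      forall i j, connect (adjacent g) i j
    & forall p : seq 'I_n, (2 < size p)%N -> ~ ucycle (adjacent g) p].

Definition Gbar (n : nat) : set (cgraph n) :=
  [set g | [/\ colored_tree g,
      forall i j k : 'I_n, (i < j < k)%N ->
        ~ (has_edge g Red i k /\ has_edge g Red j k),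
      forall i j k : 'I_n, (i < j < k)%N ->
        ~ (has_edge g Blue i j /\ has_edge g Blue i k)
    & forall i j k : 'I_n, (i < j < k)%N ->
        ~ (has_edge g Red i j /\ has_edge g Blue j k)]]%classic.
Arguments Gbar : clear implicits.

Definition lin_span (R : comPzRingType) (V : lmodType R) (B : set V) : set V :=
  [set v | exists (s : seq V) (c : V -> R),
     (forall x, x \in s -> B x) /\ v = \sum_(x <- s) c x *: x]%classic.

Definition lin_free (R : comPzRingType) (V : lmodType R) (I : eqType)
    (S : set I) (b : I -> V) : Prop :=
  forall (s : seq I) (c : I -> R),
    uniq s -> (forall i, i \in s -> S i) ->
    \sum_(i <- s) c i *: b i = 0 -> forall i, i \in s -> c i = 0.

(* The family (b i)_(i in S) is a basis of the submodule W of V. *)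
Definition is_basis (R : comPzRingType) (V : lmodType R) (W : set V)
    (I : eqType) (S : set I) (b : I -> V) : Prop :=
  lin_free S b /\ lin_span (b @` S)%classic = W.

Definition Lie2 (R : comPzRingType) (n : nat) : set (lie2 R n) :=
  lin_span (@monomial_image R n @` multilinear_monomials n)%classic.
Arguments Lie2 : clear implicits.

(* Main.v *)
Require Import Defs.
From mathcomp Require Import all_boot all_order all_algebra.
From mathcomp Require Import ring zify.
From mathcomp Require Import boolp classical_sets functions.

(** Orient a red edge from its smaller to its larger end and a blue edge from
    its larger to its smaller end. Then the graph of every multilinear monomial m
    is a tree rooted at gr m in which every other vertex has exactly one parent,
    hence lies in [Gbar n]; so S is nothing but a section of [graph].

    Every rooted tree e defines a functional on Lie_2(n): at each bracket of m,
    sum the signs of the arcs of e of the colour of the bracket that cross between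
    its two sides, and multiply over all brackets. The value is +-1 at monomials
    with graph e. If it is nonzero at m, then either m has graph e or the graph of
    m precedes e in a suitable order, defined by peeling off the least vertex.
    Hence the pairing of S with its graphs is unitriangular, which makes S free.

    For spanning, peel off the least letter v as well: the map <u, .> is a
    derivation up to terms [u, .], so Lie_2(n) is spanned by normal forms in which
    a sorted bracket u = [..[[v, b_1], b_2].., b_k] is attached by <., .> to a single
    letter of a normal form in the other letters. [graph] is injective on normal
    forms, so unitriangularity moves the spanning property from them to S. *)

Set Implicit Arguments.
Unset Strict Implicit.
Unset Printing Implicit Defensive.

Import GRing.Theory.

(** * Arcs of a monomial *)

Section Arcs.
Variable n : nat.
Implicit Types (m : monomial n) (x y z a b : 'I_n).

(** [S] is arbitrary, so triangularity has to hold for every bracketing and not only for convenient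
    ones. Therefore the order compares graphs alone, and the analysis at the least letter is carried
    out on any monomial compatible with the given tree.

    Over a commutative ring a free family of the right size need not span, so freeness and a count
    of trees would not finish the proof. Spanning is moved from normal forms to [S] by two
    unitriangular systems. The first gives coefficients on [S] such that the difference with a given
    monomial is killed by the functionals of all trees. The coefficients of this difference on
    normal forms then solve a homogeneous system of the same kind, so they vanish. *)

Definition link_color x y : color := if (x < y)%N then Red else Blue.

(** For distinct [a] and [b] exactly one disjunct is possible: the colour [c] decides which of the
    two roots becomes the parent, and by [gr_Br] that one is the root of the new bracket. *)
Definition link c a b : rel 'I_n := fun x y =>
  [&& x == a, y == b & link_color a b == c]
  || [&& x == b, y == a & link_color b a == c].

Fixpoint arcs m : rel 'I_n :=
  match m with
  | Leaf _ => fun _ _ => false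
  | Br c m1 m2 => fun x y =>
      [|| arcs m1 x y, arcs m2 x y | link c (gr m1) (gr m2) x y]
  end.

Lemma arcs_Br c m1 m2 x y : arcs (Br c m1 m2) x y =
  [|| arcs m1 x y, arcs m2 x y | link c (gr m1) (gr m2) x y].
Proof. by []. Qed.

Lemma link_color_neq c a b :
  a != b -> (link_color b a == c) = (link_color a b != c).
Proof.
by rewrite /link_color -(inj_eq val_inj); case: c; case: ltngtP.
Qed.

Lemma linkC c a b : link c a b =2 link c b a.
Proof. by move=> x y; rewrite /link orbC. Qed.

Lemma gr_Br c m1 m2 : gr (Br c m1 m2) =
  if link_color (gr m1) (gr m2) == c then gr m1 else gr m2.
Proof.
rewrite /link_color; case: c => /=; rewrite ?/Order.min ?/Order.max ?ltEord;
  by case: (ltngtP (gr m1) (gr m2)).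
Qed.

Lemma gr_BrC c m1 m2 : gr (Br c m1 m2) = gr (Br c m2 m1).
Proof. by case: c => /=; rewrite (Order.TotalTheory.minC, Order.TotalTheory.maxC). Qed.

Lemma gr_letters m : gr m \in letters m.
Proof.
elim: m => [i|c m1 IH1 m2 IH2]; first by rewrite inE.
by rewrite gr_Br [letters _]/= mem_cat; case: ifP; rewrite ?IH1 ?IH2 ?orbT.
Qed.

Lemma letters_neq c m1 m2 x y : uniq (letters (Br c m1 m2)) ->
  x \in letters m1 -> y \in letters m2 -> x != y.
Proof.
rewrite /= cat_uniq => /and3P[_ /hasPn no _] xm1 ym2.
by apply/eqP => xy; move: (no y ym2); rewrite -xy xm1.
Qed.

Lemma link_mem c m1 m2 x y : link c (gr m1) (gr m2) x y ->
  x \in letters (Br c m1 m2) /\ y \in letters (Br c m1 m2).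
Proof.
by rewrite /link /= !mem_cat => /orP[]/and3P[/eqP-> /eqP-> _];
  rewrite !gr_letters !orbT.
Qed.

Lemma arcs_letters m x y : arcs m x y -> x \in letters m /\ y \in letters m.
Proof.
elim: m => //= c m1 IH1 m2 IH2 /or3P[/IH1[]|/IH2[]|/link_mem //];
  by rewrite !mem_cat => -> ->; rewrite ?orbT.
Qed.

(** A bracket adds one arc, which enters the root that loses, never the one that survives. *)
Lemma arcs_gr m x : uniq (letters m) -> ~~ arcs m x (gr m).
Proof.
elim: m => // c m1 IH1 m2 IH2 um.
have := um; rewrite [letters _]/= cat_uniq => /and3P[u1 _ u2].
have g12 := letters_neq um (gr_letters m1) (gr_letters m2).
have n21 : forall y, y \in letters m2 -> y \in letters m1 = false.
  move=> y y2; apply/negP => y1.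
  by have := letters_neq um y1 y2; rewrite eqxx.
rewrite gr_Br [arcs _]/= /link (link_color_neq _ g12).
case: ifP => cc; apply/negP => /or3P[].
- by apply/negP/IH1.
- by case/arcs_letters => _ /(letters_neq um (gr_letters m1)); rewrite eqxx.
- by rewrite (negPf g12) ?cc !andbF.
- by case/arcs_letters => _; rewrite n21 ?gr_letters.
- by apply/negP/IH2.
- by rewrite (eq_sym (gr m2) (gr m1)) (negPf g12) ?cc !andbF.
Qed.

Lemma link_child c m1 m2 x y : link c (gr m1) (gr m2) x y ->
  (y = gr m2 /\ x = gr m1) \/ (y = gr m1 /\ x = gr m2).
Proof. by case/orP=> /and3P[/eqP-> /eqP->]; [left|right]. Qed.

Lemma arcs_parent_uniq m x y z :
  uniq (letters m) -> arcs m x z -> arcs m y z -> x = y.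
Proof.
elim: m => // c m1 IH1 m2 IH2 um.
have := um; rewrite [letters _]/= cat_uniq => /and3P[u1 _ u2].
have n12 : forall y, y \in letters m1 -> y \in letters m2 -> False.
  by move=> t y1 /(letters_neq um y1); rewrite eqxx.
have g12 := letters_neq um (gr_letters m1) (gr_letters m2).
rewrite !arcs_Br => /or3P[a1|a2|al] /or3P[b1|b2|bl].
- exact: IH1 u1 a1 b1.
- by case: (n12 z); [case: (arcs_letters a1)|case: (arcs_letters b2)].
- case/link_child: bl => -[ez _]; last by move: a1; rewrite ez (negPf (arcs_gr _ u1)).
  by case: (n12 z); [case: (arcs_letters a1)|rewrite ez gr_letters].
- by case: (n12 z); [case: (arcs_letters b1)|case: (arcs_letters a2)].
- exact: IH2 u2 a2 b2.
- case/link_child: bl => -[ez _]; first by move: a2; rewrite ez (negPf (arcs_gr _ u2)).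
  by case: (n12 z); [rewrite ez gr_letters|case: (arcs_letters a2)].
- case/link_child: al => -[ez _]; last by move: b1; rewrite ez (negPf (arcs_gr _ u1)).
  by case: (n12 z); [case: (arcs_letters b1)|rewrite ez gr_letters].
- case/link_child: al => -[ez _]; first by move: b2; rewrite ez (negPf (arcs_gr _ u2)).
  by case: (n12 z); [rewrite ez gr_letters|case: (arcs_letters b2)].
- case/link_child: al => -[ez ex]; case/link_child: bl => -[ez' ey].
  + by rewrite ex ey.
  + by move: g12; rewrite -ez -ez' eqxx.
  + by move: g12; rewrite -ez -ez' eqxx.
  + by rewrite ex ey.
Qed.

(** Acyclicity in the form used by later inductions. The ranks on the losing side are shifted above
    the rank of the surviving root, so that the new arc goes up too. *)
Lemma arcs_rank m : uniq (letters m) ->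
  exists f : 'I_n -> nat, forall x y, arcs m x y -> (f x < f y)%N.
Proof.
elim: m => [i|c m1 IH1 m2 IH2] um; first by exists (fun=> 0%N).
have := um; rewrite [letters _]/= cat_uniq => /and3P[u1 _ u2].
have [f1 f1P] := IH1 u1; have [f2 f2P] := IH2 u2.
have n12 : forall y, y \in letters m2 -> y \in letters m1 = false.
  move=> y y2; apply/negP => y1.
  by have := letters_neq um y1 y2; rewrite eqxx.
have g12 := letters_neq um (gr_letters m1) (gr_letters m2).
case: (boolP (link_color (gr m1) (gr m2) == c)) => cc.
  exists (fun x => if x \in letters m1 then f1 x else (f1 (gr m1)).+1 + f2 x)%N.
  move=> x y; rewrite arcs_Br => /or3P[a1|a2|].
  - by have [-> ->] := arcs_letters a1; apply: f1P.
  - by have [x2 y2] := arcs_letters a2; rewrite !n12 // ltn_add2l f2P.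
  - rewrite /link cc link_color_neq // cc !andbF orbF andbT.
    by case/andP=> /eqP-> /eqP->; rewrite gr_letters n12 ?gr_letters // ltn_addr.
exists (fun x => if x \in letters m1 then (f2 (gr m2)).+1 + f1 x else f2 x)%N.
move=> x y; rewrite arcs_Br => /or3P[a1|a2|].
- by have [-> ->] := arcs_letters a1; rewrite ltn_add2l f1P.
- by have [x2 y2] := arcs_letters a2; rewrite !n12 // f2P.
- rewrite /link (negPf cc) link_color_neq // cc !andbF !andbT /=.
  by case/andP=> /eqP-> /eqP->; rewrite gr_letters n12 ?gr_letters // ltn_addr.
Qed.

Lemma graph_arcs m E c : uniq (letters m) ->
  reflect (exists x y, [/\ arcs m x y, E = [set x; y]%SET & c = link_color x y])
    ((E, c) \in graph m).
Proof.
move=> um; apply: (iffP idP); elim: m um => [i|d m1 IH1 m2 IH2] um.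
- by rewrite inE.
- have g12 := letters_neq um (gr_letters m1) (gr_letters m2).
  have := um; rewrite [letters _]/= cat_uniq => /and3P[u1 _ u2].
  rewrite /= !inE => /orP[/orP[/(IH1 u1)|/(IH2 u2)]|/eqP[-> ->]].
  + by case=> x [y [a -> ->]]; exists x, y; rewrite a.
  + by case=> x [y [a -> ->]]; exists x, y; rewrite a orbT.
  + case: (eqVneq (link_color (gr m1) (gr m2)) d) => cc.
      by exists (gr m1), (gr m2); rewrite /link !eqxx cc eqxx !orbT.
    have cc' : link_color (gr m2) (gr m1) == d by rewrite link_color_neq.
    exists (gr m2), (gr m1).
    by rewrite /link !eqxx cc' !orbT finset.setUC (eqP cc').
- by case=> x [y []].
- have := um; rewrite [letters _]/= cat_uniq => /and3P[u1 _ u2].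
  case=> x [y [+ eE ec]]; rewrite /= !inE => /or3P[a|a|].
  + by rewrite IH1 //; exists x, y.
  + by rewrite IH2 ?orbT //; exists x, y.
  + case/orP=> /and3P[/eqP ex /eqP ey /eqP ed]; apply/orP; right; apply/eqP.
      by rewrite eE ec ex ey ed.
    by rewrite eE ec ex ey ed finset.setUC.
Qed.

Lemma arcs_neq m x y : uniq (letters m) -> arcs m x y -> x != y.
Proof.
move=> um a; have [f fP] := arcs_rank um.
by apply/eqP => xy; have := fP _ _ a; rewrite xy ltnn.
Qed.

Lemma set2_inj x y a b : [set x; y]%SET = [set a; b]%SET ->
  (x = a /\ y = b) \/ (x = b /\ y = a).
Proof.
move=> E.
have S z : (z \in [set x; y]%SET) = (z \in [set a; b]%SET) by rewrite E.
have := S x; have := S y; have := S a; have := S b.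
rewrite !inE !eqxx !orbT /= => Sb Sa Sy Sx.
have /orP[/eqP xa|/eqP xb] : (x == a) || (x == b) by rewrite -Sx.
  left; split=> //; have /orP[/eqP bx|/eqP->] : (b == x) || (b == y) by rewrite Sb.
    have /orP[/eqP->|/eqP-> //] : (y == a) || (y == b) by rewrite -Sy.
    by rewrite bx xa.
  by [].
right; split=> //; have /orP[/eqP ax|/eqP->] : (a == x) || (a == y) by rewrite Sa.
  have /orP[/eqP-> //|/eqP->] : (y == a) || (y == b) by rewrite -Sy.
  by rewrite ax xb.
by [].
Qed.

(** The colour of an edge tells which of its ends is the parent, so the graph determines the
    arcs. *)
Lemma graph_arcsE m x y : uniq (letters m) ->
  arcs m x y = (x != y) && (([set x; y]%SET, link_color x y) \in graph m).
Proof.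
move=> um; apply/idP/andP => [a|[nxy /(graph_arcs _ _ um)]].
  split; first exact: arcs_neq a.
  by apply/(graph_arcs _ _ um); exists x, y.
case=> a [b [ab /set2_inj[[-> ->] //|[-> ->]] /eqP]].
by rewrite link_color_neq ?eqxx //; exact: arcs_neq ab.
Qed.

Lemma eq_arcs_graph m m' : uniq (letters m) -> uniq (letters m') ->
  arcs m =2 arcs m' -> graph m = graph m'.
Proof.
move=> um um' e; apply/setP => -[E c].
by apply/(graph_arcs _ _ um)/(graph_arcs _ _ um') => -[x [y [a -> ->]]];
  exists x, y; move: a; rewrite e.
Qed.

Lemma eq_graph_arcs m m' : uniq (letters m) -> uniq (letters m') ->
  graph m = graph m' -> arcs m =2 arcs m'.
Proof. by move=> um um' e x y; rewrite !graph_arcsE // e. Qed.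

End Arcs.

(** * Trees compatible with a monomial *)

Section Restriction.
Variable T : finType.
Implicit Types (e : rel T) (x y z : T).

Definition restr (s : seq T) e : rel T := [rel x y | [&& e x y, x \in s & y \in s]].

Lemma connect_sub_rel e e' x y : subrel e e' -> connect e x y -> connect e' x y.
Proof. by move=> ee'; apply: connect_sub => a b /ee'/connect1. Qed.

Lemma connect_restr s s' e x y :
  {subset s <= s'} -> connect (restr s e) x y -> connect (restr s' e) x y.
Proof.
by move=> ss'; apply: connect_sub_rel => a b /and3P[ab /ss' ? /ss' ?]; apply/and3P.
Qed.

Lemma connect_last e x y : connect e x y -> x != y -> exists2 z, connect e x z & e z y.
Proof.
case/connectP=> p; case/lastP: p => [_ ->|p z]; first by rewrite eqxx.
rewrite rcons_path last_rcons => /andP[pp ez] -> _.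
by exists (last x p) => //; apply/connectP; exists p.
Qed.

Lemma connect_closed e (A : {pred T}) x y :
  (forall a b, a \in A -> e a b -> b \in A) -> x \in A -> connect e x y -> y \in A.
Proof.
move=> cl + /connectP[p + ->]; elim: p x => //= z p IH x xA /andP[xz pz].
by apply: IH pz; apply: cl xz.
Qed.

Lemma rank_connect e (f : T -> nat) x y :
  (forall a b, e a b -> f a < f b)%N -> connect e x y -> (f x <= f y)%N.
Proof.
move=> fP /connectP[p + ->]; elim: p x => //= z p IH x /andP[/fP xz /IH].
by apply: leq_trans (ltnW xz).
Qed.

End Restriction.

Section Compatible.
Variable n : nat.
Implicit Types (m : monomial n) (e : rel 'I_n) (x y z a b r : 'I_n).

(* At every bracket of m an arc of e of the matching colour crosses between the
   two sides; r is the vertex of m that no arc of e inside m enters. *)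
Fixpoint compat e m r : Prop :=
  match m with
  | Leaf i => r = i
  | Br c m1 m2 => exists r1 r2, [/\ compat e m1 r1, compat e m2 r2 &
      (r = r1 /\ exists a, [/\ a \in letters m1, e a r2 & link_color a r2 = c]) \/
      (r = r2 /\ exists a, [/\ a \in letters m2, e a r1 & link_color a r1 = c])]
  end.

Lemma compatC e c m1 m2 r : compat e (Br c m1 m2) r -> compat e (Br c m2 m1) r.
Proof. by case=> r1 [r2 [c1 c2 H]]; exists r2, r1; split=> //; case: H; [right|left]. Qed.

Lemma compat_root e m r : compat e m r -> r \in letters m.
Proof.
elim: m r => [i r ->|c m1 IH1 m2 IH2 r /= [r1 [r2 [/IH1 c1 /IH2 c2]]]].
  by rewrite inE.
by case=> -[-> _]; rewrite mem_cat ?c1 ?c2 ?orbT.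
Qed.

Lemma compat_connect e m r y :
  compat e m r -> y \in letters m -> connect (restr (letters m) e) r y.
Proof.
elim: m r y => [i r y /= ->|c m1 IH1 m2 IH2 r y /= [r1 [r2 [c1 c2]]]].
  by rewrite inE => /eqP->.
have s1 : {subset letters m1 <= letters m1 ++ letters m2}.
  by move=> t; rewrite mem_cat => ->.
have s2 : {subset letters m2 <= letters m1 ++ letters m2}.
  by move=> t; rewrite mem_cat orbC => ->.
have r1m := compat_root c1; have r2m := compat_root c2.
case=> -[-> [a [am ear _]]]; rewrite mem_cat => /orP[y1|y2].
- exact: connect_restr s1 (IH1 _ _ c1 y1).
- apply: connect_trans (connect_restr s1 (IH1 _ _ c1 am)) _.
  apply: (connect_trans _ (connect_restr s2 (IH2 _ _ c2 y2))).
  by apply: connect1; apply/and3P; split=> //; [exact: s1|exact: s2].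
- apply: connect_trans (connect_restr s2 (IH2 _ _ c2 am)) _.
  apply: (connect_trans _ (connect_restr s1 (IH1 _ _ c1 y1))).
  by apply: connect1; apply/and3P; split=> //; [exact: s2|exact: s1].
- exact: connect_restr s2 (IH2 _ _ c2 y2).
Qed.

Lemma compat_parent e m r y : compat e m r -> y \in letters m -> y != r ->
  exists2 x, x \in letters m & e x y.
Proof.
move=> cm ym yr; have [|z _] := connect_last (compat_connect cm ym).
  by rewrite eq_sym.
by case/and3P=> ezy zm _; exists z.
Qed.

(** The arc that a bracket draws between its two roots is a crossing arc of its colour. With
    [e := arcs m], facts about [compat] become facts about [m] itself. *)
Lemma compat_arcs e m : uniq (letters m) -> subrel (arcs m) e -> compat e m (gr m).
Proof.
elim: m => // c m1 IH1 m2 IH2 um.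
have := um; rewrite [letters _]/= cat_uniq => /and3P[u1 _ u2] sub.
have g12 := letters_neq um (gr_letters m1) (gr_letters m2).
exists (gr m1), (gr m2); split.
- by apply: IH1 => // x y a; apply: sub; rewrite arcs_Br a.
- by apply: IH2 => // x y a; apply: sub; rewrite arcs_Br a orbT.
rewrite gr_Br; case: ifP => cc; [left|right]; split=> //.
  exists (gr m1); split; [exact: gr_letters| |exact/eqP].
  by apply: sub; rewrite arcs_Br /link !eqxx cc !orbT.
have cc' : link_color (gr m2) (gr m1) == c by rewrite link_color_neq // cc.
exists (gr m2); split; [exact: gr_letters| |exact/eqP].
by apply: sub; rewrite arcs_Br /link !eqxx cc' !orbT.
Qed.

Lemma arcs_connect m y : uniq (letters m) -> y \in letters m -> connect (arcs m) (gr m) y.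
Proof.
move=> um ym; have := compat_connect (compat_arcs um (fun _ _ => id)) ym.
by apply: connect_sub_rel => a b /and3P[].
Qed.

Lemma has_edge_arcs m c x y : uniq (letters m) -> has_edge (graph m) c x y ->
  (arcs m x y /\ c = link_color x y) \/ (arcs m y x /\ c = link_color y x).
Proof.
move=> um /(graph_arcs _ _ um)[a [b [ab /set2_inj[[-> ->]|[-> ->]] ->]]]; first by left.
by right.
Qed.

Lemma adjacent_arcs m x y : uniq (letters m) ->
  adjacent (graph m) x y = arcs m x y || arcs m y x.
Proof.
move=> um; apply/orP/orP => [[]/(has_edge_arcs um)[[-> _]|[-> _]]|]; auto.
have edge a b : arcs m a b -> has_edge (graph m) (link_color a b) a b.
  by move=> ab; apply/(graph_arcs _ _ um); exists a, b.
case=> /edge; rewrite /has_edge ?(finset.setUC [set y]%SET) /link_color;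
  by case: ifP; auto.
Qed.

Lemma colored_tree_graph m : multilinear_monomials n m -> colored_tree (graph m).
Proof.
rewrite /multilinear_monomials /= => pm.
have um : uniq (letters m) by rewrite (perm_uniq pm) enum_uniq.
have all x : x \in letters m by rewrite (perm_mem pm) mem_enum.
have [f fP] := arcs_rank um.
split.
- move=> E c /(graph_arcs _ _ um)[x [y [/(arcs_neq um) xy -> _]]].
  by rewrite cards2 xy.
- move=> E c c' /(graph_arcs _ _ um)[x [y [a -> ->]]].
  case/(graph_arcs _ _ um)=> x' [y' [b /set2_inj[[-> ->] -> //|[ex ey]]]].
  by move: a; rewrite ex ey => /fP/(ltn_trans (fP _ _ b)); rewrite ltnn.
- have sym : connect_sym (adjacent (graph m)).
    by apply: sym_connect_sym => x y; rewrite !adjacent_arcs // orbC.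
  have gc x : connect (adjacent (graph m)) (gr m) x.
    apply: connect_sub_rel (arcs_connect um (all x)) => a b ab.
    by rewrite adjacent_arcs // ab.
  by move=> i j; apply: (connect_trans _ (gc j)); rewrite sym.
(* On a cycle, both neighbours of a vertex of largest rank are its parents, so they coincide. *)
- move=> p sp uc.
  have [x0 x0p] : exists x0, x0 \in p by case: p sp {uc} => // x p; exists x; rewrite inE eqxx.
  case: (@arg_maxnP _ x0 (mem p) f x0p) => x xp xmax.
  have [i q rp] := rot_to xp.
  have inp y : y \in x :: q -> y \in p by rewrite -rp mem_rot.
  have : ucycle (adjacent (graph m)) (x :: q) by rewrite -rp rot_ucycle.
  have : (2 < size (x :: q))%N by rewrite -rp size_rot.
  have par y : y \in p -> adjacent (graph m) x y -> arcs m y x.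
    move=> yp; rewrite adjacent_arcs // => /orP[/fP|//].
    by rewrite ltnNge; have := xmax y yp; rewrite /= => ->.
  case: q rp inp => [|y [|z q]] // rp inp _ /andP[/=].
  rewrite rcons_path => /and4P[xy _ _ lx] /and3P[_ + _].
  have ly : last z q \in x :: y :: z :: q by rewrite 2!in_cons mem_last !orbT.
  have a1 : arcs m y x by apply: par => //; apply: inp; rewrite !inE eqxx orbT.
  have a2 : arcs m (last z q) x.
    by apply: par; [exact: inp|move: lx; rewrite !adjacent_arcs // orbC].
  by rewrite (arcs_parent_uniq um a1 a2) mem_last.
Qed.

(** Each forbidden pattern gives one vertex two parents: [k] in the first, [i] in the second, [j] in
    the third. *)
Lemma Gbar_graph m : multilinear_monomials n m -> Gbar n (graph m).
Proof.
move=> mm; have um : uniq (letters m) by rewrite (perm_uniq mm) enum_uniq.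
have red (i j : 'I_n) : (i < j)%N -> has_edge (graph m) Red i j -> arcs m i j.
  move=> ij /(has_edge_arcs um)[[] //|[_]].
  by rewrite /link_color ltnNge (ltnW ij).
have blue (i j : 'I_n) : (i < j)%N -> has_edge (graph m) Blue i j -> arcs m j i.
  by move=> ij /(has_edge_arcs um)[[_]|[] //]; rewrite /link_color ij.
split; first exact: colored_tree_graph.
all: move=> i j k /andP[ij jk] [].
- move=> /(red _ _ (ltn_trans ij jk)) a /(red _ _ jk) b.
  by move: ij; rewrite (arcs_parent_uniq um a b) ltnn.
- move=> /(blue _ _ ij) a /(blue _ _ (ltn_trans ij jk)) b.
  by move: jk; rewrite (arcs_parent_uniq um a b) ltnn.
- move=> /(red _ _ ij) a /(blue _ _ jk) b.
  by move: (ltn_trans ij jk); rewrite (arcs_parent_uniq um a b) ltnn.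
Qed.

End Compatible.

(** * Splitting a monomial at its least letter *)

Section Forests.
Variable n : nat.
Implicit Types (m : monomial n) (ms : seq (monomial n)).

Definition fletters ms := flatten [seq letters m | m <- ms].

Definition farcs ms : rel 'I_n := fun x y => has (fun m => arcs m x y) ms.

Lemma fletters_inj ms m m' x : uniq (fletters ms) -> m \in ms -> m' \in ms ->
  x \in letters m -> x \in letters m' -> m = m'.
Proof.
elim: ms => //= m0 ms IH; rewrite /fletters /= cat_uniq => /and3P[_ /hasPn no u].
rewrite !inE => /orP[/eqP->|mi] /orP[/eqP->|mi'] // xm xm'.
- by have := no x; rewrite /= xm => /(_ _)/negP[] //; apply/flatten_mapP; exists m'.
- by have := no x; rewrite /= xm' => /(_ _)/negP[] //; apply/flatten_mapP; exists m.
- exact: IH.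
Qed.

Lemma uniq_letters_forest ms m : uniq (fletters ms) -> m \in ms -> uniq (letters m).
Proof.
elim: ms => //= m0 ms IH; rewrite /fletters /= cat_uniq => /and3P[u0 _ u].
by rewrite inE => /orP[/eqP->|/(IH u)].
Qed.

Lemma uniq_gr_forest ms : uniq (fletters ms) -> uniq [seq gr m | m <- ms].
Proof.
elim: ms => //= m0 ms IH; rewrite /fletters /= cat_uniq => /and3P[_ /hasPn no u].
rewrite IH // andbT; apply/mapP => -[m mi gg].
have /no : gr m \in fletters ms by apply/flatten_mapP; exists m; rewrite ?gr_letters.
by rewrite /= -gg gr_letters.
Qed.

Lemma farcs_mem ms x y : farcs ms x y -> exists2 m, m \in ms & arcs m x y.
Proof. by case/hasP=> m; exists m. Qed.

Lemma farcs_letters ms x y :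
  farcs ms x y -> x \in fletters ms /\ y \in fletters ms.
Proof.
case/farcs_mem=> m mi /arcs_letters[xm ym].
by split; apply/flatten_mapP; exists m.
Qed.

Lemma perm_fletters ms ms' : perm_eq ms ms' -> perm_eq (fletters ms) (fletters ms').
Proof. by move=> p; apply/perm_flatten/perm_map. Qed.

Lemma perm_farcs ms ms' : perm_eq ms ms' -> farcs ms =2 farcs ms'.
Proof. by move=> p x y; apply: eq_has_r; apply: perm_mem. Qed.

Lemma fletters_cat ms ms' : fletters (ms ++ ms') = fletters ms ++ fletters ms'.
Proof. by rewrite /fletters map_cat flatten_cat. Qed.

Lemma farcs_cat ms ms' x y : farcs (ms ++ ms') x y = farcs ms x y || farcs ms' x y.
Proof. exact: has_cat. Qed.

End Forests.

Section SplitAtLeast.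
Variables (n : nat) (e : rel 'I_n) (v : 'I_n).
Implicit Types (m : monomial n) (bs : seq (monomial n)).

(* Up to the order of the factors, u = [..[[v, b_1], b_2].., b_k] where
   bs = b_1, .., b_k. *)
Definition red_block u bs : Prop :=
  [/\ gr u = v, compat e u v,
      perm_eq (letters u) (v :: fletters bs),
      forall x y, arcs u x y = (x == v) && (y \in [seq gr b | b <- bs]) || farcs bs x y
    & {in bs, forall b, exists r, compat e b r}].

(* m arises from o by replacing a subterm b of o by <u, b>. *)
Definition blue_split m r u b o : Prop :=
  [/\ perm_eq (letters m) (letters u ++ letters o),
      gr m = gr o,
      forall x y, arcs m x y = [|| arcs u x y, arcs o x y | (x == gr b) && (y == v)],
      {subset letters b <= letters o} /\
      {in letters b, forall p, connect (arcs o) (gr b) p}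
    & (forall x y, x \in letters u -> y \in letters m -> e x y -> y \in letters u) ->
      compat e o r /\ exists2 p, p \in letters b & e p v].

(** On the way up from the leaf [v], brackets [., .] keep the least letter [v] as root, and the
    first bracket <., .> takes the root away from [v] for good; the block [u] ends there. The
    closure premise of [blue_split] stays open until descendants are counted, see [red_closed]. *)
Definition split_at m r : Prop :=
  (r = v /\ exists bs, red_block m bs) \/
  (exists u bs b o, red_block u bs /\ blue_split m r u b o).

Lemma split_atC c m1 m2 r : split_at (Br c m1 m2) r -> split_at (Br c m2 m1) r.
Proof.
have pC : perm_eq (letters (Br c m2 m1)) (letters (Br c m1 m2)) by rewrite /= perm_catC.
have aC x y : arcs (Br c m2 m1) x y = arcs (Br c m1 m2) x y.
  by rewrite !arcs_Br linkC orbCA.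
case=> [[-> [bs [g cm p a cb]]]|[u [bs [b [o [ub [p g a s cl]]]]]]].
  left; split=> //; exists bs; split=> //.
  - by rewrite gr_BrC.
  - exact: compatC.
  - exact: perm_trans p.
  - by move=> x y; rewrite aC.
right; exists u, bs, b, o; split=> //; split=> //.
- exact: perm_trans p.
- by rewrite gr_BrC.
- by move=> x y; rewrite aC.
- by move=> H; apply: cl => x y xu ym; apply: H; rewrite ?(perm_mem pC).
Qed.

(** While [v] is the root of [m1], a red bracket adds [m2] to the block, and a blue one ends the
    block with [b] and [o] both equal to [m2]. Every later bracket only enlarges [o]. *)
Lemma split_at_Br c m1 m2 r : uniq (letters (Br c m1 m2)) ->
  {in letters (Br c m1 m2), forall x : 'I_n, (v <= x)%N} ->
  (forall r1, compat e m1 r1 -> split_at m1 r1) ->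
  compat e (Br c m1 m2) r -> split_at (Br c m1 m2) r.
Proof.
move=> um vmin IH cm; have [r1 [r2 [c1 c2 H]]] := cm.
have n12 y : y \in letters m1 -> y \in letters m2 -> False.
  by move=> y1 /(letters_neq um y1); rewrite eqxx.
have vle2 x : x \in letters m2 -> (v <= x)%N.
  by move=> xm; apply: vmin; rewrite /= mem_cat xm orbT.
case: (IH _ c1) => [[r1v [bs rb]]|].
  have [g1 cv p1 a1 cb] := rb.
  have v1 : v \in letters m1 by rewrite (perm_mem p1) inE eqxx.
  have vlt x : x \in letters m2 -> (v < x)%N.
    move=> xm; rewrite ltn_neqAle vle2 // andbT.
    by apply/eqP => /val_inj vx; apply: (n12 v); rewrite // vx.
  have vg := vlt _ (gr_letters m2).
  have colv x : x \in letters m2 -> link_color v x = Red.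
    by move=> /vlt xm; rewrite /link_color xm.
  have colx x : x \in letters m2 -> link_color x v = Blue.
    by move=> /vlt xm; rewrite /link_color ltnNge (ltnW xm).
  have lk x y : link c (gr m1) (gr m2) x y = if c is Red
      then (x == v) && (y == gr m2) else (x == gr m2) && (y == v).
    rewrite /link g1 colv ?colx ?gr_letters //.
    by case: (c) => /=; rewrite ?andbT ?andbF ?orbF.
  case: c um vmin cm H lk => um vmin cm H lk.
  (* Otherwise a red arc would enter [v], but arcs into the least letter are blue. *)
  - have rv : r = v.
      case: H => -[-> //]; case=> a [am _]; rewrite r1v colx //.
    left; split=> //; exists (m2 :: bs); split.
    + by rewrite gr_Br g1 colv ?gr_letters.
    + by rewrite -rv.
    + rewrite [letters _]/= /fletters /= -cat1s perm_sym perm_catCA perm_catC.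
      by rewrite perm_cat2r perm_sym.
    + move=> x y; rewrite arcs_Br lk a1 /farcs /= !inE.
      by case: (x == v); case: (y == gr m2); case: (y \in _);
        case: (arcs m2 x y); case: (has _ _).
    + move=> b; rewrite inE => /orP[/eqP->|/cb //]; by exists r2.
  - right; exists m1, bs, m2, m2; split=> //; split=> //.
    + by rewrite gr_Br g1 colv ?gr_letters.
    + by move=> x y; rewrite arcs_Br lk.
    + by split=> // p pm; apply: arcs_connect => //; move: um; rewrite /= cat_uniq => /and3P[].
    (* An arc from [m1] to [r2] would leave the block, against [cl]; so the crossing arc enters [v]
       from [m2]. *)
    + move=> cl; case: H => -[rr [a [am ea _]]].
        have r2m := compat_root c2.
        case: (n12 r2) => //; apply: (cl a) => //.
        by rewrite /= mem_cat r2m orbT.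
      by rewrite rr; split=> //; exists a => //; rewrite -r1v.
case=> u [bs [b [o [rb [p1 g1 a1 [sb cb] cl]]]]].
have o1 : {subset letters o <= letters m1}.
  by move=> x xo; rewrite (perm_mem p1) mem_cat xo orbT.
have u1 : {subset letters u <= letters m1}.
  by move=> x xo; rewrite (perm_mem p1) mem_cat xo.
right; exists u, bs, b, (Br c o m2); split=> //; split.
- by rewrite /= catA perm_cat2r.
- by rewrite !gr_Br g1.
- move=> x y; rewrite !arcs_Br a1 g1.
  by case: (arcs u x y); case: (arcs o x y); case: (arcs m2 x y);
    case: (link _ _ _ x y); case: (_ && _).
- split=> [x /sb xo|x /cb]; first by rewrite /= mem_cat xo.
  by apply: connect_sub_rel => x' y' a; rewrite arcs_Br a.
move=> cl2; have [|co ep] := cl.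
  by move=> x y xu ym; apply: cl2 => //; rewrite /= mem_cat ym.
split=> //; exists r1, r2; split=> //.
case: H => -[rr [a [am ea ca]]]; [left|right]; split=> //; exists a; split=> //.
(* The crossing arc cannot start in [u], since it would leave [u] on its way to [r2]. *)
move: am; rewrite (perm_mem p1) mem_cat => /orP[au|//].
have r2m := compat_root c2.
case: (n12 r2) => //; apply: u1; apply: (cl2 a) => //.
by rewrite /= mem_cat r2m orbT.
Qed.

Lemma split_atP m r : uniq (letters m) -> v \in letters m ->
  {in letters m, forall x : 'I_n, (v <= x)%N} -> compat e m r -> split_at m r.
Proof.
elim: m r => [i r _ |c m1 IH1 m2 IH2 r um]; rewrite [letters _]/=.
  rewrite inE => /eqP<- _ /= ->; left; split=> //; exists [::]; split=> //.
  by move=> x y; rewrite andbF.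
have := um; rewrite [letters _]/= cat_uniq => /and3P[u1 _ u2].
rewrite mem_cat => /orP[v1|v2] vmin cm.
  apply: split_at_Br => // r1; apply: IH1 => // x xm.
  by apply: vmin; rewrite mem_cat xm.
apply/split_atC/split_at_Br => //.
- by rewrite /= uniq_catC.
- by move=> x; rewrite /= mem_cat orbC -mem_cat; apply: vmin.
- by move=> r1; apply: IH2 => // x xm; apply: vmin; rewrite mem_cat xm orbT.
- exact: compatC.
Qed.

End SplitAtLeast.

(** * Triangularity *)

(** Only a difference at a common position decides, so a strict comparison survives appending
    entries. *)
Fixpoint lexlt (s t : seq nat) : bool :=
  match s, t with
  | x :: s', y :: t' => (x < y)%N || (x == y) && lexlt s' t'
  | _, _ => false
  end.

Lemma lexlt_irr s : lexlt s s = false.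
Proof. by elim: s => //= x s ->; rewrite ltnn eqxx. Qed.

Lemma lexlt_trans : transitive lexlt.
Proof.
move=> t s u; elim: s t u => [|x s IH] [|y t] [|z u] //=.
case/orP=> [xy|/andP[/eqP-> st]] /orP[yz|/andP[/eqP<- tu]].
- by rewrite (ltn_trans xy yz).
- by rewrite xy.
- by rewrite yz.
- by rewrite eqxx (IH _ _ st tu) orbT.
Qed.

Lemma lexlt_rcons s t x y : lexlt s t -> lexlt (rcons s x) (rcons t y).
Proof.
elim: s t => [|a s IH] [|b t] //= /orP[->//|/andP[-> /IH->]].
by rewrite orbT.
Qed.

Lemma lexlt_rcons_last s x y : (x < y)%N -> lexlt (rcons s x) (rcons s y).
Proof. by move=> xy; elim: s => [|a s IH] /=; rewrite ?xy // eqxx IH orbT. Qed.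

Section Triangularity.
Variables (n : nat).
Implicit Types (m : monomial n) (ms : seq (monomial n)) (e : rel 'I_n) (s : seq 'I_n).

(* The potential of a rooted forest e on the vertices s, listed in increasing
   order: first the number of descendants of the least vertex v, then its number
   of children (the more, the smaller), then recursively the potential of the
   forest without v, and only then the depth of v. *)
Fixpoint key e s : seq nat :=
  if s is v :: s' then
    #|connect (restr s e) v| :: n - #|restr s e v| ::
    rcons (key e s') #|[pred x | connect (restr s e) x v]|
  else [::].

Lemma eq_key e e' s : {in s &, e =2 e'} -> key e s = key e' s.
Proof.
elim: s => //= v s IH ee'.
have E : restr (v :: s) e =2 restr (v :: s) e'.
  move=> x y; rewrite /restr /=.
  by case: (boolP (x \in _)) => xs; case: (boolP (y \in _)) => ys;
    rewrite ?andbF // ee'.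
rewrite (IH _); last by move=> x y xs ys; apply: ee'; rewrite inE ?xs ?ys orbT.
congr [:: _, _ & rcons _ _].
- by apply: eq_card => x; rewrite !inE; apply: eq_connect.
- by congr (_ - _); apply: eq_card => x; rewrite !inE; apply: E.
- by apply: eq_card => x; rewrite !inE; apply: eq_connect.
Qed.

(** A path to [v] without repetitions meets [v] only at its end, so its other vertices lie in
    [s]. *)
Lemma connect_first_hit s e v x : uniq (v :: s) -> x != v ->
  connect (restr (v :: s) e) x v ->
  exists2 y, connect (restr s e) x y & e y v && (y \in s).
Proof.
move=> us xv /connectP[p pp]; case/shortenP: pp => q.
case/lastP: q => [_ _ _ /eqP|q z]; first by rewrite eq_sym (negPf xv).
rewrite rcons_path last_rcons -rcons_cons rcons_uniq => /andP[pq lz] /andP[zq _] _ ez.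
move: zq lz; rewrite -ez => zq /and3P[el ls _].
have inS y : y \in x :: q -> y \in v :: s -> y \in s.
  by move=> yq; rewrite inE => /orP[/eqP yv|//]; rewrite -yv yq in zq.
have lq : last x q \in x :: q by exact: mem_last.
exists (last x q); last by rewrite el inS.
apply/connectP; exists q => //.
have: {subset x :: q <= x :: q} by [].
elim: q {lq ez el ls zq} x inS pq {xv} => //= z' q IH x inS /andP[/and3P[exz xs zs] pq] _.
rewrite /restr /= exz !inS ?inE ?eqxx ?orbT //=.
apply: IH => // y yq; apply: inS; by rewrite inE yq orbT.
Qed.

(** * Comparison of two forests at their least vertex *)

Section Step.
Variables (e : rel 'I_n) (f : 'I_n -> nat).
Hypothesis e_parent : forall x y z, e x z -> e y z -> x = y.
Hypothesis e_rank : forall x y, e x y -> (f x < f y)%N.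

Lemma restr_connect_rank s x y : connect (restr s e) x y -> (f x <= f y)%N.
Proof. by apply: rank_connect => a b /and3P[/e_rank]. Qed.

Lemma restr_connect_rank_lt s x y :
  connect (restr s e) x y -> x != y -> (f x < f y)%N.
Proof.
move=> c xy; have [z /restr_connect_rank xz /and3P[/e_rank zy _ _]] := connect_last c xy.
exact: leq_ltn_trans zy.
Qed.

Variables (v : 'I_n) (s : seq 'I_n).
Hypothesis us : uniq (v :: s).
Variables (u : monomial n) (bs : seq (monomial n)) (h : rel 'I_n).
Hypothesis rb : red_block e v u bs.
Hypothesis su : {subset letters u <= v :: s}.
Hypothesis uu : uniq (letters u).
Hypothesis hu : forall x y, x \in letters u -> h x y = arcs u x y.

Let E := restr (v :: s) e.
Let H := restr (v :: s) h.

Let vu : v \in letters u. Proof. by case: rb => <- *; apply: gr_letters. Qed.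

Let ubs : uniq (fletters bs) /\ v \notin fletters bs.
Proof. by case: rb => _ _ p _ _; move: uu; rewrite (perm_uniq p) /= => /andP[]. Qed.

Let bsu b : b \in bs -> {subset letters b <= letters u}.
Proof.
move=> bi x xb; case: rb => _ _ p _ _; rewrite (perm_mem p) inE.
by apply/orP; right; apply/flatten_mapP; exists b.
Qed.

Let bsnv b : b \in bs -> v \notin letters b.
Proof.
move=> bi; apply/negP => vb; case/negP: (ubs.2).
by apply/flatten_mapP; exists b.
Qed.

Lemma red_desc_sub : connect H v \subset letters u.
Proof.
apply/fintype.subsetP => x; rewrite inE; apply: connect_closed => // a b au /and3P[].
by rewrite hu // => /arcs_letters[].
Qed.

Lemma red_desc_sup : letters u \subset connect E v.
Proof.
apply/fintype.subsetP => x xu; rewrite inE.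
by case: rb => _ /compat_connect/(_ xu) + _ _ _; apply: connect_restr.
Qed.

(** Arcs of [h] that start in [u] stay in [u], whereas [e] reaches all of [u] from [v] by
    compatibility. *)
Lemma red_desc_card : (#|connect H v| <= #|connect E v|)%N.
Proof. exact: subset_leq_card (fintype.subset_trans red_desc_sub red_desc_sup). Qed.

Hypothesis desc_eq : #|connect H v| = #|connect E v|.

Lemma red_desc_eq : connect E v =i letters u.
Proof.
apply/fsym/subset_cardP; last exact: red_desc_sup.
apply/eqP; rewrite eqn_leq (subset_leq_card red_desc_sup) -desc_eq.
exact: subset_leq_card red_desc_sub.
Qed.

(** Equal counts make [letters u] the set of all [e]-descendants of [v]. This supplies the closure
    premise of [blue_split]. *)
Lemma red_closed x y : x \in letters u -> y \in v :: s -> e x y -> y \in letters u.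
Proof.
move=> xu ys exy; have xs := su xu; move: xu; rewrite -!red_desc_eq !inE => vx.
by apply: connect_trans vx (connect1 _); rewrite /E /restr /= exy xs.
Qed.

Variable rt : monomial n -> 'I_n.
Hypothesis rtP : {in bs, forall b, compat e b (rt b)}.

(** A vertex of [b] other than the [e]-root of [b] already has its unique parent inside [b], so it
    is not a child of [v]. *)
Lemma red_children_sub : {subset enum (E v) <= [seq rt b | b <- bs]}.
Proof.
move=> y; rewrite mem_enum => /and3P[evy _ ys].
have := red_closed vu ys evy; case: (rb) => _ _ p _ _; rewrite (perm_mem p) inE.
case/orP=> [/eqP yv|/flatten_mapP[b bi yb]].
  by have := e_rank evy; rewrite yv ltnn.
case: (eqVneq y (rt b)) => [->|yr]; first exact: map_f.
have [x xb exy] := compat_parent (rtP bi) yb yr.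
by have := bsnv bi; rewrite (e_parent evy exy) xb.
Qed.

Lemma red_children_H : #|H v| = size bs.
Proof.
rewrite -(size_map (@gr n)) -(card_uniqP (uniq_gr_forest ubs.1)).
apply: eq_card => y; rewrite [in LHS]inE /H /restr /= hu //.
case: rb => gu _ p -> _; rewrite eqxx /=.
have -> : farcs bs v y = false.
  by apply/negP => /farcs_letters[vb _]; case/negP: (ubs.2).
rewrite orbF inE eqxx; case: (boolP (y \in _)) => //= /mapP[b bi ->].
by rewrite su // (bsu bi) ?gr_letters.
Qed.

Lemma red_children_card : (#|E v| <= #|H v|)%N.
Proof.
rewrite red_children_H -(size_map rt) cardE.
by apply: uniq_leq_size (enum_uniq _) red_children_sub.
Qed.

Hypothesis children_eq : #|E v| = #|H v|.

Lemma red_children_eq y : E v y = (y \in [seq rt b | b <- bs]).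
Proof.
have [|_ <-] := uniq_min_size (enum_uniq _) red_children_sub.
  by rewrite size_map -red_children_H -children_eq cardE.
by rewrite mem_enum.
Qed.

(** Equal numbers of children make every [rt b] a child of [v], which is not in [s]; all other
    vertices of [b] have their parent in [b]. So no arc crosses between blocks once [v] is deleted,
    as the recursive call requires. *)
Lemma red_arc_block x y : x \in s -> y \in letters u -> y != v -> e x y ->
  exists2 b, b \in bs & (x \in letters b) && (y \in letters b).
Proof.
move=> xs yu yv exy; move: yu; case: (rb) => _ _ p _ _.
rewrite (perm_mem p) inE (negPf yv) /= => /flatten_mapP[b bi yb].
exists b => //; rewrite yb andbT.
case: (eqVneq y (rt b)) => [yr|yr].
  have : E v y by rewrite red_children_eq yr map_f.
  case/and3P=> evy _ _; move: us => /andP[+ _].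
  by rewrite (e_parent evy exy) xs.
have [z zb ezy] := compat_parent (rtP bi) yb yr.
by rewrite (e_parent exy ezy).
Qed.

Hypothesis agree : {in s &, e =2 h}.

(** Otherwise [gr b] has an [e]-parent in [b]. As [e] and [h] agree there, this is an arc of [b]
    into its own root. *)
Lemma red_root_gr b : b \in bs -> rt b = gr b.
Proof.
move=> bi; apply/eqP; rewrite eq_sym; apply: contraT => gr_rt.
have ub := uniq_letters_forest ubs.1 bi.
have [x xb exg] := compat_parent (rtP bi) (gr_letters b) gr_rt.
have ins z : z \in letters b -> z \in s.
  move=> zb; have := su (bsu bi zb); rewrite inE => /orP[/eqP zv|//].
  by have := bsnv bi; rewrite -zv zb.
have : h x (gr b) by rewrite -agree // ins ?gr_letters.
rewrite hu ?(bsu bi) //; case: (rb) => _ _ _ -> _.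
case/orP=> [/andP[/eqP xv _]|/farcs_mem[b' bi' a]].
  by have := bsnv bi; rewrite -xv xb.
have [xb' _] := arcs_letters a.
move: a; rewrite -(fletters_inj ubs.1 bi bi' xb xb').
by rewrite (negPf (arcs_gr _ ub)).
Qed.

Lemma red_agree_children y : y \in v :: s -> e v y = h v y.
Proof.
move=> ys; have -> : e v y = E v y by rewrite /E /restr /= mem_head ys !andbT.
rewrite red_children_eq hu //; case: (rb) => _ _ _ -> _; rewrite eqxx /=.
have -> : farcs bs v y = false.
  by apply/negP => /farcs_letters[vb _]; case/negP: (ubs.2).
by rewrite orbF; congr (_ \in _); apply/eq_in_map => b; apply: red_root_gr.
Qed.

End Step.

(** Deleting the least vertex breaks a tree into several, so the induction runs over forests. Each
    comparison in the key relies on equality in the earlier ones: equal numbers of descendants make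
    [u] closed, equal numbers of children leave no arc across the smaller forest, and agreement on
    [s] allows the parents of [v] to be compared. *)
Lemma forest_key e (f : 'I_n -> nat) s ms :
  (forall x y z, e x z -> e y z -> x = y) ->
  (forall x y, e x y -> (f x < f y)%N) ->
  sorted (fun x y : 'I_n => x < y)%N s ->
  perm_eq (fletters ms) s ->
  {in ms, forall m, exists r, compat e m r} ->
  (forall x y, x \in s -> y \in s -> e x y ->
     exists2 m, m \in ms & (x \in letters m) && (y \in letters m)) ->
  {in s &, e =2 farcs ms} \/ lexlt (key (farcs ms) s) (key e s).
Proof.
move=> e_parent e_rank; elim: s ms => [|v s IH] ms; first by left.
move=> srt pms cms ncross.
have tr : transitive (fun x y : 'I_n => x < y)%N by move=> y x z; apply: ltn_trans.
have vmin : {in s, forall x : 'I_n, (v < x)%N} by apply/allP/(order_path_min tr).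
have us : uniq (v :: s).
  by apply: sorted_uniq srt => // x; rewrite ltnn.
have [m mi vm] : exists2 m, m \in ms & v \in letters m.
  by apply/flatten_mapP; rewrite (perm_mem pms) mem_head.
have pm := perm_to_rem mi; set ms' := rem m ms in pm.
have umf : uniq (fletters ms) by rewrite (perm_uniq pms).
have um := uniq_letters_forest umf mi.
have inms x : x \in letters m -> x \in fletters ms' -> False.
  move: umf; rewrite (perm_uniq (perm_fletters pm)) /fletters /= cat_uniq.
  by move=> /and3P[_ /hasPn no _] xm /no; rewrite /= xm.
have ms'i m' : m' \in ms' -> m' \in ms by rewrite (perm_mem pm) inE orbC => ->.
have hE x y : farcs ms x y = arcs m x y || farcs ms' x y by rewrite (perm_farcs pm).
have hm x y : x \in letters m -> farcs ms x y = arcs m x y.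
  move=> xm; rewrite hE; case: (boolP (farcs ms' x y)) => [/farcs_letters[xm' _]|_].
    by case: (inms x).
  by rewrite orbF.
have sm : {subset letters m <= v :: s}.
  by move=> x xm; rewrite -(perm_mem pms); apply/flatten_mapP; exists m.
have [r cm] := cms m mi.
have vmin' : {in letters m, forall x : 'I_n, (v <= x)%N}.
  by move=> x /sm; rewrite inE => /orP[/eqP->//|/vmin/ltnW].
set h := farcs ms.
have eirr x : e x x = false by apply/negP => /e_rank; rewrite ltnn.
have snv x : x \in s -> x != v by move=> xs; apply/eqP => xv; move: us; rewrite -xv /= xs.
(* Once the first two entries of the keys agree, [IH] applies to the forest
   obtained from [ms] by removing [v]. *)
suff main u bs ms2 : red_block e v u bs -> {subset letters u <= letters m} -> uniq (letters u) ->
   (forall x y, x \in letters u -> h x y = arcs u x y) ->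
   perm_eq (fletters ms2) s -> {in s &, h =2 farcs ms2} ->
   ((forall x y, x \in letters u -> y \in v :: s -> e x y -> y \in letters u) ->
     [/\ {in ms2, forall m, exists r, compat e m r},
      forall x y, x \in s -> y \in s -> y \notin letters u -> e x y ->
       exists2 m, m \in ms2 & (x \in letters m) && (y \in letters m)
     & {in s &, e =2 h} ->
       {in s, forall x, e x v = h x v} \/
       (#|[pred x | connect (restr (v :: s) h) x v]| <
        #|[pred x | connect (restr (v :: s) e) x v]|)%N]) ->
   {subset bs <= ms2} ->
   {in v :: s &, e =2 h} \/ lexlt (key h (v :: s)) (key e (v :: s)).
  have vms' : v \in fletters ms' -> False by apply: inms.
  have farcs_v x : farcs ms' x v = false by apply/negP => /farcs_letters[_ /vms'].
  have pvs : perm_eq (letters m ++ fletters ms') (v :: s).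
    by apply: perm_trans pms; rewrite perm_sym; exact: perm_fletters pm.
  have other x y : x \in v :: s -> y \in v :: s -> e x y ->
      (x \in letters m) && (y \in letters m) \/
      exists2 m', m' \in ms' & (x \in letters m') && (y \in letters m').
    move=> xs ys exy; have [m0 + xy] := ncross x y xs ys exy.
    by rewrite (perm_mem pm) inE => /orP[/eqP<-|m0i]; [left|right; exists m0].
  case: (split_atP um vm vmin' cm) => [[rv [bs rb]]|[u [bs [b [o [rb bl]]]]]].
    have [gm _ pmb am cb] := rb.
    apply: (main m bs (bs ++ ms')) => //.
    - rewrite -(perm_cons v) fletters_cat -cat_cons.
      by apply: perm_trans pvs; rewrite perm_cat2r perm_sym.
    - by move=> x y xs _; rewrite /h hE farcs_cat am (negPf (snv _ xs)).
    - move=> _; split.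
      + by move=> m'; rewrite mem_cat => /orP[/cb//|/ms'i/cms].
      + move=> x y xs ys ym exy.
        have [|//|/andP[_ ym']|[m' mi' xy]] := other x y _ _ exy;
          rewrite ?in_cons ?xs ?ys ?orbT //; first by rewrite ym' in ym.
        by exists m' => //; rewrite mem_cat mi' orbT.
      (* Here [v] is a root of both forests: an [e]-parent of [v] would lie in [m], hence below
         [v]. *)
      + move=> _; left=> x xs.
        have -> : h x v = false.
          by rewrite /h hE farcs_v orbF -gm (negPf (arcs_gr _ um)).
        apply/negP => exv.
        have [||/andP[xm _]|[m' mi' /andP[_ vm']]] := other x v _ _ exv;
          rewrite ?in_cons ?xs ?eqxx ?orbT //.
          have := compat_connect cm xm; rewrite rv => /(restr_connect_rank e_rank).
          by rewrite leqNgt e_rank.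
        by apply: vms'; apply/flatten_mapP; exists m'.
    - by move=> b bi; rewrite mem_cat bi.
  have [gu cu pu au cb] := rb.
  have [pmo gmo am [sb cnb] cl] := bl.
  have uo : uniq (letters u ++ letters o) by rewrite -(perm_uniq pmo).
  have uno x : x \in letters u -> x \in letters o -> False.
    move: uo; rewrite cat_uniq => /and3P[_ /hasPn no _] xu /no.
    by rewrite /= xu.
  have uu : uniq (letters u) by move: uo; rewrite cat_uniq => /and3P[].
  have vu : v \in letters u by rewrite (perm_mem pu) mem_head.
  have umem x : x \in letters u -> x \in letters m by rewrite (perm_mem pmo) mem_cat => ->.
  have omem x : x \in letters o -> x \in letters m.
    by rewrite (perm_mem pmo) mem_cat => ->; rewrite orbT.
  have os x : x \in letters o -> x \in s.
    move=> xo; have := sm _ (omem _ xo); rewrite inE => /orP[/eqP xv|//].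
    by case: (uno v); rewrite // -xv.
  have gbo : gr b \in letters o by apply/sb/gr_letters.
  have hv x : h x v = (x == gr b).
    rewrite /h hE farcs_v orbF am -{1}gu (negPf (arcs_gr _ uu)) eqxx andbT.
    by case: (boolP (arcs o x v)) => [/arcs_letters[_ vo]|//]; case: (uno v).
  apply: (main u bs (o :: bs ++ ms')) => //.
  - move=> x y xu; rewrite /h hm ?umem // am.
    case: (boolP (arcs o x y)) => [/arcs_letters[xo _]|_]; first by case: (uno x).
    case: (eqVneq x (gr b)) => [xg|_]; first by case: (uno x); rewrite // xg.
    by rewrite !orbF.
  - rewrite -(perm_cons v); apply: perm_trans pvs.
    rewrite -cat1s /fletters /= -/(fletters _) fletters_cat -(cat1s v) perm_catCA.
    rewrite !catA perm_cat2r perm_sym; apply: perm_trans pmo _.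
    by rewrite -catA perm_catC perm_cat2l.
  - move=> x y xs ys; rewrite /h hE am au (negPf (snv _ xs)) (negPf (snv _ ys)) andbF orbF.
    by rewrite /= farcs_cat; case: (farcs bs x y); case: (arcs o x y).
  - move=> clo; have [|co [p pb epv]] := cl.
      by move=> x y xu ym; apply: clo => //; apply: sm.
    split.
    + move=> m'; rewrite inE mem_cat => /or3P[/eqP->|/cb//|/ms'i/cms //].
      by exists r.
    + move=> x y xs ys yu exy.
      have [||/andP[]|[m' mi' xy]] := other x y _ _ exy;
        rewrite ?in_cons ?xs ?ys ?orbT //; last first.
        by exists m' => //; rewrite inE mem_cat mi' !orbT.
      rewrite !(perm_mem pmo) !mem_cat (negPf yu) /= => xuo yo.
      exists o; first exact: mem_head.
      rewrite yo andbT; case/orP: xuo => // xu.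
      by move: yu; rewrite (clo x y) // inE ys orbT.
    (* The parent of [v] is [gr b] under [h] and [p] under [e]. If they differ, [p] lies strictly
       below [gr b], so [v] has strictly more ancestors under [e]. *)
    + move=> agr; case: (eqVneq p (gr b)) => [pg|pg].
        left=> x xs; rewrite hv -pg; apply/idP/eqP => [exv|->//].
        exact: e_parent exv epv.
      have hs x : x != v -> connect (restr (v :: s) h) x v -> connect (restr s e) x (gr b).
        move=> xv /(connect_first_hit us xv)[y cxy]; rewrite hv => /andP[/eqP<- _].
        apply: connect_sub_rel cxy => a c /and3P[hac as_ cs].
        by rewrite /restr /= agr // hac as_ cs.
      have bp : connect (restr s e) (gr b) p.
        apply: connect_sub_rel (cnb p pb) => a c ac; have [ao co'] := arcs_letters ac.
        rewrite /restr /= !os // !andbT agr ?os // /h hE am ac.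
        by rewrite orbT.
      right; apply: proper_card; apply/properP; split.
        apply/fintype.subsetP => x; rewrite !inE.
        case: (eqVneq x v) => [->//|xv /(hs x xv) cx].
        have ss : {subset s <= v :: s} by move=> z zs; rewrite inE zs orbT.
        apply: connect_trans (connect_restr ss (connect_trans cx bp)) _.
        by apply: connect1; rewrite /restr /= epv mem_head inE os ?sb // orbT.
      exists p; rewrite !inE.
        by apply: connect1; rewrite /restr /= epv mem_head inE os ?sb // orbT.
      apply/negP => /(hs p (snv _ (os _ (sb _ pb))))/(restr_connect_rank e_rank).
      rewrite leqNgt => /negP; apply.
      by apply: (restr_connect_rank_lt e_rank bp); rewrite eq_sym.
  - by move=> b' bi; rewrite inE mem_cat bi orbT.
move=> rb um' uu hu p2 h2 Hcl bs2.
have su : {subset letters u <= v :: s} by move=> x /um'/sm.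
have [lt1|eq1] := ltnP #|connect (restr (v :: s) h) v| #|connect (restr (v :: s) e) v|.
  by right; rewrite /= lt1.
have {}eq1 : #|connect (restr (v :: s) h) v| = #|connect (restr (v :: s) e) v|.
  by apply/eqP; rewrite eqn_leq eq1 (red_desc_card rb su hu).
have cl := red_closed rb su hu eq1.
have {Hcl}[c2 nc2 Hv] := Hcl cl.
have [rt rtP] : exists rt, {in bs, forall b, compat e b (rt b)}.
  have : forall b, exists r, b \in bs -> compat e b r.
    move=> b; case: (boolP (b \in bs)) => [bi|_]; last by exists v.
    by case: rb => _ _ _ _ /(_ _ bi)[r0 ?]; exists r0.
  by case/choice=> rt rtP; exists rt => b /rtP.
have le2 := red_children_card e_parent e_rank rb su uu hu eq1 rtP.
have [lt2|eq2] := ltnP #|restr (v :: s) e v| #|restr (v :: s) h v|.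
  (* The truncated subtraction is strictly decreasing here, as [v] has fewer than [n] children under
     [e]. *)
  right; rewrite /= eq1 eqxx ltnn /= ltn_sub2l //.
  by apply: leq_trans lt2 _; rewrite -[X in (_ <= X)%N]card_ord max_card.
have {le2}eq2 : #|restr (v :: s) e v| = #|restr (v :: s) h v|.
  by apply/eqP; rewrite eqn_leq le2 eq2.
have nc x y : x \in s -> y \in s -> e x y ->
     exists2 m, m \in ms2 & (x \in letters m) && (y \in letters m).
  move=> xs ys exy; case: (boolP (y \in letters u)) => yu; last exact: nc2.
  have [b bi xyb] := red_arc_block e_parent e_rank us rb su uu hu eq1 rtP eq2 xs yu (snv _ ys) exy.
  by exists b => //; apply: bs2.
have srt' : sorted (fun x y : 'I_n => x < y)%N s by apply: path_sorted srt.
have kh : key h s = key (farcs ms2) s by apply: eq_key.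
have [agr|lt3] := IH ms2 srt' p2 c2 nc; last first.
  by right; rewrite /= eq1 eq2 !eqxx !ltnn /= kh lexlt_rcons.
have {}agr : {in s &, e =2 h} by move=> x y xs ys; rewrite agr // h2.
have ke : key h s = key e s by apply: eq_key => x y xs ys; rewrite agr.
have [pv|lt4] := Hv agr; last first.
  by right; rewrite /= eq1 eq2 !eqxx !ltnn /= ke lexlt_rcons_last.
left=> x y; rewrite inE => /orP[/eqP->|xs] ys.
  exact: (red_agree_children e_parent e_rank rb su uu hu eq1 rtP eq2 agr).
by move: ys; rewrite inE => /orP[/eqP->|ys]; [apply: pv|apply: agr].
Qed.

End Triangularity.

(** * The pairing *)

Section Pairing.
Variables (R : comPzRingType) (n : nat) (e : rel 'I_n).
Local Open Scope ring_scope.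
Implicit Types (A B C D : {set 'I_n}) (m : monomial n).

(** The signs make the cut weights antisymmetric. This and additivity over disjoint unions are the
    only properties of weights behind [pair_axioms]. *)
Definition arc_weight c (a b : 'I_n) : R :=
  (e a b && (link_color a b == c))%:R - (e b a && (link_color b a == c))%:R.

Definition cut_weight c A B : R := \sum_(a in A) \sum_(b in B) arc_weight c a b.

Lemma cut_weightC c A B : cut_weight c A B = - cut_weight c B A.
Proof.
rewrite /cut_weight exchange_big /= -sumrN; apply: eq_bigr => a _.
by rewrite -sumrN; apply: eq_bigr => b _; rewrite opprB.
Qed.

Lemma cut_weightU c A B C : [disjoint B & C] ->
  cut_weight c A (B :|: C)%SET = cut_weight c A B + cut_weight c A C.
Proof.
move=> dBC; rewrite /cut_weight -big_split /=; apply: eq_bigr => a _.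
by rewrite -bigU //=; apply: eq_bigl => b; rewrite !inE.
Qed.

Definition parts2 A B C := (B :|: C == A)%SET && [disjoint B & C].
Definition parts3 A B C D :=
  [&& (B :|: (C :|: D) == A)%SET, [disjoint B & C], [disjoint B & D] & [disjoint C & D]].

Definition pair_alg := {ffun {set 'I_n} -> R^o}.

(** The recursion of [pairing], written as a bracket on functions of letter sets so that the
    universal property can produce the functional. *)
Definition pair_br c (f g : pair_alg) : pair_alg :=
  [ffun A => \sum_B \sum_(C | parts2 A B C) cut_weight c B C * (f B * g C)].

Lemma pair_br_br c c' (f g h : pair_alg) A :
  pair_br c f (pair_br c' g h) A =
  \sum_B \sum_C \sum_(D | parts3 A B C D)
    ((cut_weight c B C + cut_weight c B D) * cut_weight c' C D * (f B * g C * h D)).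
Proof.
rewrite ffunE; apply: eq_bigr => B _.
under eq_bigr => E _ do rewrite ffunE !mulr_sumr.
rewrite exchange_big /=; apply: eq_bigr => C _.
under eq_bigr => E _ do rewrite !mulr_sumr.
rewrite (exchange_big_dep xpredT) //= [RHS]big_mkcond /=; apply: eq_bigr => D _.
rewrite (eq_bigl (fun E => (E == C :|: D)%SET && parts3 A B C D)); last first.
  move=> E; rewrite /parts2 /parts3; case: (eqVneq E (C :|: D)%SET) => [->|nE].
    rewrite /= [[disjoint B & C :|: D]]disjoint_sym.
    have -> : [disjoint C :|: D & B] = [disjoint B & C] && [disjoint B & D].
      rewrite ![[disjoint B & _]]disjoint_sym -disjointU; apply: eq_disjoint => x.
      by rewrite !inE.
    by rewrite -!andbA.
  by rewrite /= andbF.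
case: (boolP (parts3 A B C D)) => [/and4P[_ _ _ dCD]|_]; last first.
  by rewrite big_pred0 // => E; rewrite andbF.
rewrite (eq_bigl (pred1 (C :|: D)%SET)) => [|E]; last by rewrite andbT.
rewrite big_pred1_eq cut_weightU //.
rewrite -!mulrA; congr (_ * _); rewrite mulrCA; congr (_ * _); exact: mulrA.
Qed.

Lemma parts3_rot A B C D : parts3 A B C D = parts3 A C D B.
Proof.
rewrite /parts3 [in RHS]finset.setUA [in RHS](finset.setUC (C :|: D)%SET).
rewrite (disjoint_sym (mem C) (mem B)) (disjoint_sym (mem D) (mem B)).
by congr (_ && _); rewrite andbA andbC.
Qed.

Lemma sum_parts3_rot A (F : {set 'I_n} -> {set 'I_n} -> {set 'I_n} -> R) :
  \sum_B \sum_C \sum_(D | parts3 A B C D) F B C D =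
  \sum_B \sum_C \sum_(D | parts3 A B C D) F C D B.
Proof.
under eq_bigr => C _ do rewrite (exchange_big_dep xpredT) //=.
rewrite exchange_big /=; apply: eq_bigr => B _; apply: eq_bigr => C _.
by apply: eq_bigl => D; rewrite -parts3_rot.
Qed.

(** Reindexing gives all three summands the common factor [f B * g C * h D], which reduces the
    Jacobi identities to identities between cut weights. *)
Lemma pair_br_cyclic c c' (f g h : pair_alg) A :
  pair_br c f (pair_br c' g h) A + pair_br c g (pair_br c' h f) A
    + pair_br c h (pair_br c' f g) A =
  \sum_B \sum_C \sum_(D | parts3 A B C D)
    ((cut_weight c B C + cut_weight c B D) * cut_weight c' C D +
     (cut_weight c C D + cut_weight c C B) * cut_weight c' D B +
     (cut_weight c D B + cut_weight c D C) * cut_weight c' B C) * (f B * g C * h D).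
Proof.
rewrite !pair_br_br [X in _ + X + _]sum_parts3_rot.
rewrite [X in _ + X]sum_parts3_rot [X in _ + X]sum_parts3_rot -!big_split.
apply: eq_bigr => B _; rewrite -!big_split; apply: eq_bigr => C _.
by rewrite -!big_split; apply: eq_bigr => D _ /=; ring.
Qed.

(** By [pair_br_cyclic] the Jacobi identity is the vanishing of a quadratic form in the three cut
    weights of a splitting, a consequence of antisymmetry. The mixed identity is the polarization of
    that form at the red and the blue weights. *)
Lemma pair_axioms : lie2_axioms pair_br.
Proof.
split; first split.
- move=> c a f g h; apply/ffunP => A; rewrite !ffunE.
  rewrite [X in _ = X + _]scaler_sumr -big_split; apply: eq_bigr => B _ /=.
  rewrite scaler_sumr -big_split; apply: eq_bigr => C _ /=.
  rewrite !ffunE /GRing.scale /=; ring.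
- move=> c a f g h; apply/ffunP => A; rewrite !ffunE.
  rewrite [X in _ = X + _]scaler_sumr -big_split; apply: eq_bigr => B _ /=.
  rewrite scaler_sumr -big_split; apply: eq_bigr => C _ /=.
  rewrite !ffunE /GRing.scale /=; ring.
- move=> c f g; apply/ffunP => A; rewrite !ffunE.
  rewrite [X in _ + X](exchange_big_dep xpredT) //= -big_split big1 //= => B _.
  rewrite [X in _ + X](eq_bigl (parts2 A B)) => [|C]; last first.
    by rewrite /parts2 finset.setUC disjoint_sym.
  rewrite -big_split big1 //= => C _; rewrite [g C * f B]mulrC -mulrDl.
  by rewrite cut_weightC addNr mul0r.
- move=> c f g h; apply/ffunP => A; rewrite [RHS]ffunE.
  transitivity (pair_br c f (pair_br c g h) A + pair_br c g (pair_br c h f) A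
    + pair_br c h (pair_br c f g) A); first by rewrite !ffunE.
  rewrite pair_br_cyclic big1 // => B _; rewrite big1 // => C _; rewrite big1 // => D _.
  rewrite (cut_weightC c C B) (cut_weightC c D B) (cut_weightC c D C); ring.
- move=> f g h; apply/ffunP => A; rewrite [RHS]ffunE.
  transitivity (
    (pair_br Red f (pair_br Blue g h) A + pair_br Red g (pair_br Blue h f) A
       + pair_br Red h (pair_br Blue f g) A) +
    (pair_br Blue f (pair_br Red g h) A + pair_br Blue g (pair_br Red h f) A
       + pair_br Blue h (pair_br Red f g) A)); first by rewrite !ffunE !addrA.
  rewrite !pair_br_cyclic -big_split big1 // => B _.
  rewrite -big_split big1 // => C _; rewrite -big_split big1 // => D _ /=.
  rewrite !(cut_weightC _ C B) !(cut_weightC _ D B) !(cut_weightC _ D C); ring.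
Qed.

Definition lset m := [set x in letters m]%SET.

Fixpoint pairing m : R :=
  match m with
  | Leaf _ => 1
  | Br c m1 m2 => cut_weight c (lset m1) (lset m2) * (pairing m1 * pairing m2)
  end.

Definition pair_gen (i : 'I_n) : pair_alg := [ffun A => (A == [set i]%SET)%:R].

Lemma pairing_functional : exists F : lie2 R n -> R,
  (forall a u v, F (a *: u + v) = a * F u + F v) /\
  forall m, multilinear_monomials n m -> F (monomial_image R m) = pairing m.
Proof.
have [F [[Flin Fbr Fgen] _]] := lie2_universal pair_gen pair_axioms.
(* The image of a monomial is a function supported on its own letter set, so multilinear monomials
   are read off at the full set. *)
exists (fun u => F u (finset.setTfor 'I_n)); split=> [a u v|m mm]; first by rewrite Flin !ffunE.
suff H m' : uniq (letters m') -> forall A,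
    F (monomial_image R m') A = (A == lset m')%:R * pairing m'.
  rewrite H ?(perm_uniq mm) ?enum_uniq // (_ : lset m = finset.setTfor 'I_n) ?eqxx ?mul1r //.
  by apply/setP => x; rewrite !inE (perm_mem mm) mem_enum.
elim: m' => [i _ A|c m1 IH1 m2 IH2 um A] /=.
  rewrite Fgen ffunE mulr1; congr (_ == _)%:R.
  by apply/setP => x; rewrite !inE.
have := um; rewrite [letters _]/= cat_uniq => /and3P[u1 _ u2].
rewrite Fbr ffunE (bigD1 (lset m1)) //= [X in _ + X]big1 ?addr0 => [|B nB]; last first.
  by rewrite big1 // => C _; rewrite IH1 // (negPf nB) mul0r mul0r mulr0.
under eq_bigr => C _ do rewrite IH1 // IH2 // eqxx mul1r.
have lU : (lset m1 :|: lset m2 = lset (Br c m1 m2))%SET.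
  by apply/setP => x; rewrite !inE mem_cat.
have ld : [disjoint lset m1 & lset m2].
  rewrite -setI_eq0; apply/eqP/setP => x; rewrite !inE.
  by apply/negP => /andP[x1 /(letters_neq um x1)]; rewrite eqxx.
rewrite big_mkcond (bigD1 (lset m2)) //= [X in _ + X]big1 ?addr0 => [|C nC]; last first.
  by case: ifP => // _; rewrite (negPf nC) mul0r !mulr0.
rewrite /parts2 lU ld andbT eqxx mul1r eq_sym.
by case: eqP => _; rewrite ?mul1r ?mul0r.
Qed.

Hypothesis e_parent : forall x y z, e x z -> e y z -> x = y.

(** A nonzero factor requires an arc of its colour across the cut. The head of that arc must be the
    [e]-root of its side, because every other vertex has its unique parent on its own side. *)
Lemma pairing_compat m : uniq (letters m) -> pairing m <> 0 ->
  exists r, compat e m r.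
Proof.
elim: m => [i _ _|c m1 IH1 m2 IH2 um /= ne]; first by exists i.
have := um; rewrite [letters _]/= cat_uniq => /and3P[u1 _ u2].
have [r1 c1] : exists r, compat e m1 r.
  by apply: IH1 => // z; apply: ne; rewrite z mul0r mulr0.
have [r2 c2] : exists r, compat e m2 r.
  by apply: IH2 => // z; apply: ne; rewrite z mulr0 mulr0.
have n12 y : y \in letters m1 -> y \in letters m2 -> False.
  by move=> y1 /(letters_neq um y1); rewrite eqxx.
have [a [b [a1 b2 w]]] : exists a b,
    [/\ a \in letters m1, b \in letters m2 & arc_weight c a b <> 0].
  apply: contrapT => H; apply: ne; rewrite /cut_weight big1 ?mul0r // => a.
  rewrite inE => a1; rewrite big1 // => b; rewrite inE => b2.
  by apply: contrapT => w; apply: H; exists a, b.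
have : e a b && (link_color a b == c) \/ e b a && (link_color b a == c).
  case: (boolP (e a b && _)) => [|p1]; first by left.
  case: (boolP (e b a && _)) => [|p2]; first by right.
  by case: w; rewrite /arc_weight (negPf p1) (negPf p2) subrr.
case=> /andP[eab /eqP cc].
  have br : b = r2.
    apply/eqP; apply: contraT => nb; have [x x2 exb] := compat_parent c2 b2 nb.
    by case: (n12 a); rewrite // (e_parent eab exb).
  by exists r1, r1, r2; split=> //; left; split=> //; exists a; rewrite -br.
have ar : a = r1.
  apply/eqP; apply: contraT => nb; have [x x2 exb] := compat_parent c1 a1 nb.
  by case: (n12 b); rewrite // (e_parent eab exb).
by exists r2, r1, r2; split=> //; right; split=> //; exists b; rewrite -ar.
Qed.

(** At each bracket the only crossing arc joins the two roots, so the factor is 1 or -1. The square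
    avoids tracking signs and shows each diagonal entry to be its own inverse. *)
Lemma pairing_diag m : uniq (letters m) -> {in letters m &, e =2 arcs m} ->
  pairing m * pairing m = 1.
Proof.
elim: m => [i _ _|c m1 IH1 m2 IH2 um agr /=]; first by rewrite mulr1.
have := um; rewrite [letters _]/= cat_uniq => /and3P[u1 _ u2].
have n12 y : y \in letters m1 -> y \in letters m2 -> False.
  by move=> y1 /(letters_neq um y1); rewrite eqxx.
have in1 x : x \in letters m1 -> x \in letters (Br c m1 m2).
  by rewrite /= mem_cat => ->.
have in2 x : x \in letters m2 -> x \in letters (Br c m1 m2).
  by rewrite /= mem_cat orbC => ->.
have no1 x y : x \in letters m2 \/ y \in letters m2 -> arcs m1 x y = false.
  move=> H; apply/negP => /arcs_letters[x1 y1].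
  by case: H => [/(n12 _ x1)|/(n12 _ y1)].
have no2 x y : x \in letters m1 \/ y \in letters m1 -> arcs m2 x y = false.
  move=> H; apply/negP => /arcs_letters[x1 y1].
  by case: H => [/n12/(_ x1)|/n12/(_ y1)].
have p1 : pairing m1 * pairing m1 = 1.
  apply: IH1 => // x y x1 y1; rewrite agr ?in1 // arcs_Br (no2 x y); last by left.
  case: (boolP (link _ _ _ x y)) => [/link_child[][ey ex]|_]; last by rewrite !orbF.
    by case: (n12 y); rewrite // ey gr_letters.
  by case: (n12 x); rewrite // ex gr_letters.
have p2 : pairing m2 * pairing m2 = 1.
  apply: IH2 => // x y x1 y1; rewrite agr ?in2 // arcs_Br (no1 x y); last by left.
  case: (boolP (link _ _ _ x y)) => [/link_child[][ey ex]|_]; last by rewrite orbF.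
    by case: (n12 x); rewrite // ex gr_letters.
  by case: (n12 y); rewrite // ey gr_letters.
have g12 := letters_neq um (gr_letters m1) (gr_letters m2).
pose d : R := (link_color (gr m1) (gr m2) == c)%:R - (link_color (gr m1) (gr m2) != c)%:R.
have w a b : a \in letters m1 -> b \in letters m2 ->
    arc_weight c a b = ((a == gr m1) && (b == gr m2))%:R * d.
  move=> a1 b2; have [a0 b0] := (in1 _ a1, in2 _ b2).
  rewrite /arc_weight !agr // !arcs_Br.
  rewrite (no1 a b (or_intror b2)) (no1 b a (or_introl b2)).
  rewrite (no2 a b (or_introl a1)) (no2 b a (or_intror a1)).
  have ag : a == gr m2 = false by apply: negbTE; apply: letters_neq um a1 (gr_letters _).
  have bg : b == gr m1 = false.
    by apply: negbTE; rewrite eq_sym; apply: letters_neq um (gr_letters _) b2.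
  rewrite /link ag bg /= ?andbF ?orbF /d.
  case: (eqVneq a (gr m1)) => [->|_]; case: (eqVneq b (gr m2)) => [->|_] /=;
    rewrite ?andbF ?mul0r ?subrr //.
  by rewrite (link_color_neq c g12) !andbb mul1r.
have -> : cut_weight c (lset m1) (lset m2) = d.
  rewrite /cut_weight (bigD1 (gr m1)) ?inE ?gr_letters //= [X in _ + X]big1 ?addr0; last first.
    move=> a /andP[]; rewrite inE => a1 na; rewrite big1 // => b; rewrite inE => b2.
    by rewrite w // (negPf na) mul0r.
  rewrite (bigD1 (gr m2)) ?inE ?gr_letters //= [X in _ + X]big1 ?addr0; last first.
    by move=> b /andP[]; rewrite inE => b2 nb; rewrite w ?gr_letters // (negPf nb) andbF mul0r.
  by rewrite w ?gr_letters // !eqxx mul1r.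
have dd : d * d = 1.
  by rewrite /d; case: (_ == c); rewrite /= ?subr0 ?mulr1 // sub0r mulrNN mulr1.
by rewrite mulrACA dd mul1r mulrACA p1 p2 mulr1.
Qed.

End Pairing.

(** * Spans and substitution *)

Section LinearSpan.
Variables (R : comPzRingType) (V : lmodType R).
Local Open Scope ring_scope.
Implicit Types (B : set V) (x v : V).

(** [lin_span] attaches coefficients to vectors and not to positions, so a repeated vector counts
    with its multiplicity. *)
Lemma lin_span_uniq B v : lin_span B v -> exists (s : seq V) (c : V -> R),
  [/\ uniq s, forall x, x \in s -> B x & v = \sum_(x <- s) c x *: x].
Proof.
case=> s [c [sB ->]]; exists (undup s), (fun x => c x *+ count_mem x s).
split; [exact: undup_uniq|by move=> x; rewrite mem_undup; apply: sB|].
rewrite -big_undup_iterop_count; apply: eq_bigr => x _.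
by rewrite -scalerMnl.
Qed.

Lemma lin_span0 B : lin_span B 0.
Proof. by exists [::], (fun=> 0); split=> //; rewrite big_nil. Qed.

Lemma lin_span_cons B a x v : B x -> lin_span B v -> lin_span B (a *: x + v).
Proof.
move=> Bx /lin_span_uniq[s [c [us sB ->]]].
case: (boolP (x \in s)) => xs.
  exists s, (fun y => if y == x then a + c y else c y); split=> //.
  rewrite (bigD1_seq x) //= [in RHS](bigD1_seq x) //= eqxx scalerDl addrA.
  by congr (_ + _); apply: eq_bigr => y /negPf->.
exists (x :: s), (fun y => if y == x then a else c y); split.
  by move=> y; rewrite inE => /orP[/eqP->|/sB].
rewrite big_cons eqxx; congr (_ + _); apply: eq_big_seq => y ys.
by case: eqP => // yx; rewrite -yx ys in xs.
Qed.

Lemma lin_span_sub B B' x :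
  (forall y, B y -> B' y) -> lin_span B x -> lin_span B' x.
Proof. by move=> BB' [s [c [sB ->]]]; exists s, c; split=> // y /sB/BB'. Qed.

Lemma lin_span_ind B (P : V -> Prop) : P 0 ->
  (forall a x v, B x -> P v -> P (a *: x + v)) -> forall v, lin_span B v -> P v.
Proof.
move=> P0 PS v [s [c [sB ->]]]; elim: s sB => [|x s IH] sB; first by rewrite big_nil.
rewrite big_cons; apply: PS; first by apply: sB; rewrite mem_head.
by apply: IH => y ys; apply: sB; rewrite inE ys orbT.
Qed.

Lemma lin_span_mem B x : B x -> lin_span B x.
Proof. by move=> Bx; have := lin_span_cons 1 Bx (lin_span0 B); rewrite scale1r addr0. Qed.

Lemma lin_spanD B x v : lin_span B x -> lin_span B v -> lin_span B (x + v).
Proof.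
move=> + Bv; move: x; apply: lin_span_ind => [|a x w Bx IH]; first by rewrite add0r.
by rewrite -addrA; apply: lin_span_cons.
Qed.

Lemma lin_spanZ B a x : lin_span B x -> lin_span B (a *: x).
Proof.
move: x; apply: lin_span_ind => [|b y w By IH]; first by rewrite scaler0; apply: lin_span0.
by rewrite scalerDr scalerA; apply: lin_span_cons.
Qed.

End LinearSpan.

Lemma lin_span_map (R : comPzRingType) (V W : lmodType R) (f : V -> W)
    (B : set V) (B' : set W) v :
  (forall a x y, f (a *: x + y)%R = (a *: f x + f y)%R) ->
  (forall x, B x -> lin_span B' (f x)) -> lin_span B v -> lin_span B' (f v).
Proof.
move=> flin fB; move: v; apply: lin_span_ind => [|a x w Bx IH]; last first.
  by rewrite flin; apply: lin_spanD => //; apply/lin_spanZ/fB.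
have -> : f 0%R = 0%R; last exact: lin_span0.
have := flin 1%R 0%R 0%R; rewrite !scale1r addr0 => /eqP.
by rewrite addrC -subr_eq subrr eq_sym => /eqP.
Qed.

(** * Bracket identities and substitution for a letter *)

Section Substitution.
Variables (R : comPzRingType) (n : nat).
Local Open Scope ring_scope.
Implicit Types (m q : monomial n) (x y z : lie2 R n) (c : color).
Local Notation br := (@lie2_br R n).
Local Notation im := (@monomial_image R n).
Local Notation gen := (@lie2_gen R n).

Lemma brLl c a x y z : br c (a *: x + y) z = a *: br c x z + br c y z.
Proof. by case: (lie2_satisfies_axioms R n) => -[]. Qed.

Lemma brLr c a x y z : br c z (a *: x + y) = a *: br c z x + br c z y.
Proof. by case: (lie2_satisfies_axioms R n) => -[]. Qed.

Lemma brDl c x y z : br c (x + y) z = br c x z + br c y z.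
Proof. by have := brLl c 1 x y z; rewrite !scale1r. Qed.

Lemma brDr c x y z : br c z (x + y) = br c z x + br c z y.
Proof. by have := brLr c 1 x y z; rewrite !scale1r. Qed.

Lemma brC c x y : br c x y = - br c y x.
Proof.
by case: (lie2_satisfies_axioms R n) => _ /(_ c x y)/eqP + _ _; rewrite addr_eq0 => /eqP.
Qed.

Lemma br0l c z : br c 0 z = 0.
Proof. by apply: (addrI (br c 0 z)); rewrite -brDl !addr0. Qed.

Lemma br0r c z : br c z 0 = 0.
Proof. by rewrite brC br0l oppr0. Qed.

Lemma brZl c a x z : br c (a *: x) z = a *: br c x z.
Proof. by have := brLl c a x 0 z; rewrite br0l !addr0. Qed.

Lemma brZr c a x z : br c z (a *: x) = a *: br c z x.
Proof. by rewrite brC brZl -scalerN -brC. Qed.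

Lemma brNl c x z : br c (- x) z = - br c x z.
Proof. by rewrite -scaleN1r brZl scaleN1r. Qed.

Lemma brNr c x z : br c z (- x) = - br c z x.
Proof. by rewrite -scaleN1r brZr scaleN1r. Qed.

Lemma brBl c x y z : br c (x - y) z = br c x z - br c y z.
Proof. by rewrite brDl brNl. Qed.

Lemma br_suml c (I : Type) (s : seq I) (F : I -> lie2 R n) z :
  br c (\sum_(i <- s) F i) z = \sum_(i <- s) br c (F i) z.
Proof.
elim: s => [|i s IH]; first by rewrite !big_nil br0l.
by rewrite !big_cons brDl IH.
Qed.

Lemma br_sumr c (I : Type) (s : seq I) (F : I -> lie2 R n) z :
  br c z (\sum_(i <- s) F i) = \sum_(i <- s) br c z (F i).
Proof.
elim: s => [|i s IH]; first by rewrite !big_nil br0r.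
by rewrite !big_cons brDr IH.
Qed.

Lemma red_jacobi x y z :
  br Red (br Red x y) z = br Red (br Red x z) y + br Red x (br Red y z).
Proof.
case: (lie2_satisfies_axioms R n) => _ _ /(_ Red x y z) + _.
rewrite (brC _ z x) brNr (brC _ y (br _ x z)) opprK (brC _ z) => /eqP.
by rewrite subr_eq0 addrC => /eqP.
Qed.

Lemma blue_jacobi x y z :
  br Blue x (br Blue y z) = br Blue (br Blue x y) z + br Blue y (br Blue x z).
Proof.
case: (lie2_satisfies_axioms R n) => _ _ /(_ Blue x y z) + _.
rewrite (brC _ z x) brNr (brC _ z) => /eqP; rewrite -addrA -opprD subr_eq0 => /eqP->.
exact: addrC.
Qed.

(** The last three terms measure how far <x, .> is from a derivation of [., .]; in each of them [x]
    enters a bracket [., .] first. *)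
Lemma mixed_jacobi x y z :
  br Blue x (br Red y z) = br Red (br Blue x y) z + br Red y (br Blue x z)
    - br Red x (br Blue y z) + br Blue (br Red x y) z + br Blue y (br Red x z).
Proof.
case: (lie2_satisfies_axioms R n) => _ _ _ /(_ x y z).
rewrite !(brC _ z x) !brNr (brC _ z (br Blue x y)) (brC _ z (br Red x y)).
set A := br Red x _; set B := br Red y _; set C := br Red (br _ _ _) z.
set D := br Blue x _; set E := br Blue y _; set F := br Blue _ z => /eqP.
rewrite !subr_eq add0r addrC eq_sym -subr_eq => /eqP <-.
by rewrite addrC !opprB !addrA.
Qed.

Fixpoint subst (p : 'I_n) (t m : monomial n) : monomial n :=
  match m with
  | Leaf i => if i == p then t else Leaf i
  | Br c m1 m2 => Br c (subst p t m1) (subst p t m2)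
  end.

Fixpoint eval_at (g : 'I_n -> lie2 R n) m : lie2 R n :=
  match m with
  | Leaf i => g i
  | Br c m1 m2 => br c (eval_at g m1) (eval_at g m2)
  end.

(** Unlike [subst], it inserts an element of the algebra, so that linear combinations can be
    substituted. *)
Definition plug (p : 'I_n) x : monomial n -> lie2 R n :=
  eval_at (fun i => if i == p then x else gen i).

Lemma plugB p x c m1 m2 : plug p x (Br c m1 m2) = br c (plug p x m1) (plug p x m2).
Proof. by []. Qed.

Lemma plug_id p x m : p \notin letters m -> plug p x m = im m.
Proof.
elim: m => [i|c m1 IH1 m2 IH2]; rewrite /plug /= ?inE => pm.
  by rewrite eq_sym (negPf pm).
by move: pm; rewrite mem_cat negb_or => /andP[/IH1<- /IH2<-].
Qed.

Lemma image_subst p t m : im (subst p t m) = plug p (im t) m.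
Proof. by elim: m => [i|c m1 IH1 m2 IH2] /=; [rewrite /plug /=; case: ifP|rewrite plugB IH1 IH2]. Qed.

Lemma plug_plug (p q : 'I_n) x m m' : q \notin letters m' \/ q = p ->
  plug p (plug q x m) m' = plug q x (subst p m m').
Proof.
move=> H; elim: m' H => [i|c m1 IH1 m2 IH2] H /=.
  rewrite {1}/plug /=; case: ifP => // ip.
  rewrite /plug /=; case: eqP => // iq; case: H => [|qp]; first by rewrite inE iq eqxx.
  by rewrite iq qp eqxx in ip.
rewrite !plugB -IH1 -?IH2 //; case: H; try by right.
- by rewrite mem_cat negb_or => /andP[_ ->]; left.
- by rewrite mem_cat negb_or => /andP[-> _]; left.
Qed.

Lemma plug_linear p a x y m : uniq (letters m) -> p \in letters m ->
  plug p (a *: x + y) m = a *: plug p x m + plug p y m.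
Proof.
elim: m => [i _|c m1 IH1 m2 IH2 um]; first by rewrite inE /plug /= eq_sym => ->.
have := um; rewrite [letters _]/= cat_uniq mem_cat => /and3P[u1 /hasPn no u2].
rewrite !plugB => /orP[p1|p2].
  have p2 : p \notin letters m2 by apply/negP => /no; rewrite /= p1.
  by rewrite IH1 // brLl !(plug_id _ p2).
by rewrite IH2 // brLr !(plug_id _ (no _ p2)).
Qed.

Lemma plug_endomorphism p x : exists f : lie2 R n -> lie2 R n,
  (forall a u v, f (a *: u + v) = a *: f u + f v) /\ forall m, f (im m) = plug p x m.
Proof.
have [f [[flin fbr fgen] _]] := lie2_universal
  (fun i => if i == p then x else gen i) (lie2_satisfies_axioms R n).
exists f; split=> //; elim=> [i|c m1 IH1 m2 IH2] /=; first by rewrite fgen.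
by rewrite fbr plugB IH1 IH2.
Qed.

Lemma perm_letters_subst p t m : uniq (letters m) -> p \in letters m ->
  perm_eq (p :: letters (subst p t m)) (letters t ++ letters m).
Proof.
have sid q : p \notin letters q -> subst p t q = q.
  elim: q => [i|c m1 IH1 m2 IH2] /=; rewrite ?inE => pm.
    by rewrite eq_sym (negPf pm).
  by move: pm; rewrite mem_cat negb_or => /andP[/IH1-> /IH2->].
elim: m => [i _|c m1 IH1 m2 IH2 um].
  by rewrite inE => /eqP<- /=; rewrite eqxx -cat1s perm_catC.
have := um; rewrite [letters _]/= cat_uniq mem_cat => /and3P[u1 /hasPn no u2] /orP[p1|p2] /=.
  have p2 : p \notin letters m2 by apply/negP => /no; rewrite /= p1.
  by rewrite (sid _ p2) catA -cat_cons perm_cat2r IH1.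
rewrite (sid _ (no _ p2)); apply/permP => P.
by have := permP (IH2 u2 p2) P; rewrite /= !count_cat; lia.
Qed.

(** [q'] is [q] with the bracket at the leaf [v] contracted back to [v]. The scalar [a] is the sign
    of moving [v] to the left of that bracket. *)
Lemma innermost_bracket v q : uniq (letters q) -> v \in letters q ->
  q = Leaf v \/ exists c b q' (a : R),
    [/\ v \in letters q', perm_eq (letters q) (letters q' ++ letters b)
      & forall y, plug v y q = a *: plug v (br c y (im b)) q'].
Proof.
elim: q => [i _|c q1 IH1 q2 IH2 uq]; first by rewrite inE => /eqP<-; left.
have := uq; rewrite [letters _]/= cat_uniq mem_cat => /and3P[u1 /hasPn no u2].
case/orP=> [v1|v2]; right.
  have v2 : v \notin letters q2 by apply/negP => /no; rewrite /= v1.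
  case: (IH1 u1 v1) => [->|[d [b [q' [a [vq' pq E]]]]]].
    exists c, q2, (Leaf v), 1; split; rewrite ?inE //= => y.
    by rewrite scale1r plugB (plug_id _ v2) /plug /= eqxx.
  exists d, b, (Br c q' q2), a; split=> [||y].
  - by rewrite /= mem_cat vq'.
  - by apply/permP => P; have := permP pq P; rewrite /= !count_cat; lia.
  - by rewrite !plugB E !(plug_id _ v2) brZl.
have v1 : v \notin letters q1 := no _ v2.
case: (IH2 u2 v2) => [->|[d [b [q' [a [vq' pq E]]]]]].
  exists c, q1, (Leaf v), (-1); split=> [||y]; rewrite ?inE //=.
    by rewrite -[v :: letters q1]cat1s perm_catC.
  by rewrite scaleN1r plugB (plug_id _ v1) /plug /= eqxx -brC.
exists d, b, (Br c q1 q'), a; split=> [||y].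
- by rewrite /= mem_cat vq' orbT.
- by apply/permP => P; have := permP pq P; rewrite /= !count_cat; lia.
- by rewrite !plugB E !(plug_id _ v1) brZr.
Qed.

(* The map <x, .> is a derivation of both brackets, up to terms in which x is
   first bracketed by [., .]. *)
Lemma blue_derivation v x b : v \notin letters b -> uniq (letters b) ->
  lin_span [set z | exists b' q, [/\ v \in letters q,
        perm_eq (v :: letters b) (letters b' ++ letters q)
      & z = plug v (br Red x (im b')) q]]%classic
    (br Blue x (im b) - \sum_(p <- letters b) plug p (br Blue x (gen p)) b).
Proof.
elim: b => [i _ _|c b1 IH1 b2 IH2 vb ub].
  by rewrite big_seq1 /plug /= eqxx subrr; apply: lin_span0.
have := ub; rewrite [letters _]/= cat_uniq => /and3P[u1 /hasPn no u2].
have no' p : p \in letters b1 -> p \notin letters b2 by move=> p1; apply/negP => /no; rewrite /= p1.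
move: vb; rewrite [letters _]/= mem_cat negb_or => /andP[v1 v2].
rewrite big_cat /=.
rewrite (eq_big_seq (fun p => br c (plug p (br Blue x (gen p)) b1) (im b2))) => [|p p1]; last first.
  by rewrite plugB (plug_id _ (no' _ p1)).
rewrite [X in _ - (_ + X)](eq_big_seq
    (fun p => br c (im b1) (plug p (br Blue x (gen p)) b2))) => [|p p2]; last first.
  by rewrite plugB (plug_id _ (no _ p2)).
rewrite -br_suml -br_sumr.
set B := [set z | _]%classic.
set s1 := \sum_(p <- letters b1) _; set s2 := \sum_(p <- letters b2) _.
have D1 : lin_span B (br c (br Blue x (im b1) - s1) (im b2)).
  apply: (lin_span_map (f := fun z => br c z (im b2))) (IH1 v1 u1) => [a y z|z].
    exact: brLl.
  case=> b' [q [vq pq ->]]; apply: lin_span_mem; exists b', (Br c q b2); split.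
  - by rewrite /= mem_cat vq.
  - by apply/permP => P; have := permP pq P; rewrite /= !count_cat; lia.
  - by rewrite plugB (plug_id _ v2).
have D2 : lin_span B (br c (im b1) (br Blue x (im b2) - s2)).
  apply: (lin_span_map (f := fun z => br c (im b1) z)) (IH2 v2 u2) => [a y z|z].
    exact: brLr.
  case=> b' [q [vq pq ->]]; apply: lin_span_mem; exists b', (Br c b1 q); split.
  - by rewrite /= mem_cat vq orbT.
  - by apply/permP => P; have := permP pq P; rewrite /= !count_cat; lia.
  - by rewrite plugB (plug_id _ v1).
(* The defect of a bracket is its own Leibniz defect plus the defects of its two factors. The first
   vanishes for Blue and is given by [mixed_jacobi] for Red. *)
have dist (X : lie2 R n) : X - (br c s1 (im b2) + br c (im b1) s2) =
    (X - br c (br Blue x (im b1)) (im b2) - br c (im b1) (br Blue x (im b2)))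
    + (br c (br Blue x (im b1) - s1) (im b2) + br c (im b1) (br Blue x (im b2) - s2)).
  by rewrite brBl brDr brNr addrACA subrKA addKr -addrA -opprD.
rewrite dist; apply: lin_spanD; last exact: lin_spanD.
case: c {D1 D2 dist ub} @B => B; last first.
  rewrite blue_jacobi -addrA -opprD subrr; exact: lin_span0.
rewrite mixed_jacobi.
set X1 := br Red (br Blue _ _) _; set X2 := br Red (im b1) _.
have -> : forall a b c : lie2 R n, X1 + X2 - a + b + c - X1 - X2 = (-1) *: a + (b + c).
  move=> a b c; rewrite scaleN1r -(addrA _ (- X1)) -opprD; apply/eqP.
  by rewrite subr_eq [X in _ == X]addrC !addrA.
have pc1 : perm_eq (v :: letters b1 ++ letters b2) ((letters b1 ++ letters b2) ++ [:: v]).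
  by rewrite -cat1s perm_catC.
apply: lin_span_cons.
  exists (Br Blue b1 b2), (Leaf v); split; rewrite ?inE //=.
  by rewrite /plug /= eqxx.
apply: lin_spanD; apply: lin_span_mem.
  exists b1, (Br Blue (Leaf v) b2); split; rewrite /= ?inE ?eqxx //.
    by apply/permP => P; rewrite /= !count_cat /=; lia.
  by rewrite plugB (plug_id _ v2) /plug /= eqxx.
exists b2, (Br Blue b1 (Leaf v)); split; rewrite /= ?mem_cat ?inE ?eqxx ?orbT //.
  by apply/permP => P; rewrite /= !count_cat /=; lia.
by rewrite plugB (plug_id _ v1) /plug /= eqxx.
Qed.

End Substitution.

(** * Normal forms *)

Section NormalForms.
Variable n : nat.
Implicit Types (m u b o q : monomial n) (v w p : 'I_n).

(** For a leaf this is [v] itself, which is below the root of every block, so the first block meets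
    the order condition automatically. *)
Definition last_root m : 'I_n := if m is Br _ _ b then gr b else gr m.

Fixpoint nblocks m : nat := if m is Br _ u _ then (nblocks u).+1 else 0.

(* nf v true u: u = [..[[v, b_1], b_2].., b_k] with normal b_i, v less than all
   letters of the b_i, and gr b_1 < .. < gr b_k.
   nf v false m: m is a normal o, with letters greater than v, in which one
   letter p was replaced by <u, p>, where nf v true u. *)
Inductive nf : 'I_n -> bool -> monomial n -> Prop :=
| nf_leaf v : nf v true (Leaf v)
| nf_red v w d u b : nf v true u -> nf w d b -> (v < w)%N ->
    (last_root u < gr b)%N -> nf v true (Br Red u b)
| nf_blue v w d u o p : nf v true u -> nf w d o -> (v < w)%N ->
    p \in letters o -> nf v false (subst p (Br Blue u (Leaf p)) o).

Lemma subst_letters_sub p t m x :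
  x \in letters (subst p t m) -> x \in letters t \/ x \in letters m.
Proof.
elim: m => [i|c m1 IH1 m2 IH2] /=; first by case: ifP; [left|right].
by rewrite !mem_cat => /orP[/IH1|/IH2] []; rewrite ?mem_cat => ->; rewrite ?orbT; auto.
Qed.

Lemma subst_letters_sup p t m x : p \in letters m ->
  x \in letters t -> x \in letters (subst p t m).
Proof.
move=> + xt; elim: m => [i|c m1 IH1 m2 IH2] /=; first by rewrite inE eq_sym => ->.
by rewrite !mem_cat => /orP[/IH1->|/IH2->]; rewrite ?orbT.
Qed.

Lemma nf_min v d m : nf v d m ->
  v \in letters m /\ {in letters m, forall x : 'I_n, (v <= x)%N}.
Proof.
elim=> {v d m} [v|v w d u b _ [vu umin] _ [wb bmin] vw _
               |v w d u o p _ [vu umin] _ [wo omin] vw po].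
- by split=> [|x]; rewrite inE // => /eqP->.
- split=> [|x]; rewrite /= mem_cat ?vu // => /orP[/umin//|/bmin].
  exact: leq_trans (ltnW vw).
- split; first by apply: subst_letters_sup => //=; rewrite mem_cat vu.
  move=> x /subst_letters_sub[|/omin]; last exact: leq_trans (ltnW vw).
  rewrite /= mem_cat inE => /orP[/umin//|/eqP->].
  exact: leq_trans (ltnW vw) (omin _ po).
Qed.

Lemma nf_min_gt v w d m : nf w d m -> {in letters m, forall x : 'I_n, (v < x)%N} -> (v < w)%N.
Proof. by case/nf_min=> wm _; apply. Qed.

Lemma nf_true_inv v u : nf v true u -> u = Leaf v \/ exists w d u' b,
  [/\ u = Br Red u' b, nf v true u', nf w d b, (v < w)%N & (last_root u' < gr b)%N].
Proof.
move Et : true => t nu; case: nu Et => {v t u} [v|v w d u b nu nb vw lt|//] _.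
  by left.
by right; exists w, d, u, b.
Qed.

Variable R : comPzRingType.
Local Notation br := (@lie2_br R n).
Local Notation im := (@monomial_image R n).
Local Open Scope ring_scope.

Definition nf_images (L : seq 'I_n) : set (lie2 R n) :=
  [set x | exists v d m, [/\ nf v d m, perm_eq (letters m) L & x = im m]]%classic.

Definition red_images v k (L : seq 'I_n) : set (lie2 R n) :=
  [set x | exists u, [/\ nf v true u, perm_eq (letters u) L, (nblocks u <= k)%N
    & x = im u]]%classic.

Section InductionStep.
Variable N : nat.
Hypothesis IHN : forall m, (size (letters m) < N)%N -> uniq (letters m) ->
  lin_span (nf_images (letters m)) (im m).

(** Insertion sort: [red_jacobi] moves [b] past the last block [b'] at the cost of [u', [b', b]],
    where the two are merged into one block. The remainder thus has fewer blocks, which keeps the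
    recursion going. The bound on [last_root z] allows [b'] to be put back on top of [z]. *)
Lemma nf_red_insert v k u b w d :
  nf v true u -> nf w d b -> (v < w)%N -> (nblocks u <= k)%N ->
  uniq (letters u ++ letters b) -> (size (letters u ++ letters b) <= N)%N ->
  exists z, [/\ nf v true z, perm_eq (letters z) (letters u ++ letters b),
     (nblocks z <= k.+1)%N,
     forall t : 'I_n, (last_root u < t)%N -> (gr b < t)%N -> (last_root z < t)%N
   & lin_span (red_images v k (letters u ++ letters b)) (br Red (im u) (im b) - im z)].
Proof.
elim: k u b w d => [|k IHk] u b w d nu nb vw ku ub sN.
  case: (nf_true_inv nu) => [uv|[w' [d' [u' [b' [uE]]]]]]; last by rewrite uE in ku.
  subst u.
  exists (Br Red (Leaf v) b); split=> //.
    apply: (nf_red _ nb vw); first exact: nf_leaf.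
    by apply: leq_trans vw _; apply: (nf_min nb).2; apply: gr_letters.
  by rewrite subrr; apply: lin_span0.
case: (ltnP (last_root u) (gr b)) => lb.
  exists (Br Red u b); split=> //; first exact: (nf_red nu nb vw).
  by rewrite subrr; apply: lin_span0.
case: (nf_true_inv nu) => [uv|[w' [d' [u' [b' [uE nu' nb' vw' lt']]]]]].
  subst u; move: lb => /=; rewrite leqNgt => /negP[].
  by apply: leq_trans vw _; apply: (nf_min nb).2; apply: gr_letters.
subst u; move: ku ub sN lb => /= ku ub sN lb.
have gbb : (gr b < gr b')%N.
  rewrite ltn_neqAle lb andbT; apply/eqP => /val_inj gg.
  move: ub; rewrite -catA cat_uniq => /and3P[_ _]; rewrite cat_uniq => /and3P[_ /hasPn no _].
  by have := no _ (gr_letters b); rewrite /= gg gr_letters.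
have p1 : perm_eq ((letters u' ++ letters b') ++ letters b)
                  ((letters u' ++ letters b) ++ letters b').
  by apply/permP => P; rewrite !count_cat; lia.
have u1 : uniq (letters u' ++ letters b).
  by move: ub; rewrite (perm_uniq p1) cat_uniq => /and3P[].
have szb : (0 < size (letters b'))%N by case: (letters b') (gr_letters b').
have szu : (0 < size (letters u'))%N by case: (letters u') (gr_letters u').
have [||z [nz pz kz lz Dz]] := IHk u' b w d nu' nb vw _ u1; first by [].
  by move: sN; rewrite !size_cat; lia.
have nzb : nf v true (Br Red z b') by apply: (nf_red nz nb' vw'); apply: lz.
exists (Br Red z b'); split=> //.
- by rewrite (permPr p1) /= perm_cat2r.
rewrite red_jacobi.
have -> : br Red (br Red (im u') (im b)) (im b') + br Red (im u') (br Red (im b') (im b))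
    - im (Br Red z b') = br Red (br Red (im u') (im b) - im z) (im b')
    + br Red (im u') (im (Br Red b' b)).
  by rewrite brBl /= addrAC.
apply: lin_spanD.
  apply: (lin_span_map (f := fun x => br Red x (im b'))) Dz => [a x y|x].
    exact: brLl.
  case=> u2 [nu2 pu2 ku2 ->].
  have p2 : perm_eq (letters u2 ++ letters b') ((letters u' ++ letters b') ++ letters b).
    by rewrite (permPr p1) perm_cat2r.
  have [||z2 [nz2 pz2 kz2 _ Dz2]] := IHk u2 b' w' d' nu2 nb' vw' ku2.
  - by rewrite (perm_uniq p2).
  - by rewrite (perm_size p2).
  rewrite -[br _ _ _](subrK (im z2)); apply: lin_spanD; last first.
    by apply: lin_span_mem; exists z2; split=> //; apply: perm_trans p2.
  apply: lin_span_sub Dz2 => y [u3 [nu3 pu3 ku3 ->]]; exists u3; split=> //.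
    exact: perm_trans p2.
  exact: leqW.
have ubb : uniq (letters (Br Red b' b)).
  by move: ub; rewrite -catA cat_uniq => /and3P[].
(* [b', b] need not be normal, but without the letters of [u'] it has fewer than [N] letters. *)
apply: (lin_span_map (f := fun x => br Red (im u') x)) (IHN _ ubb) => [a x y|x|].
- exact: brLr.
- case=> v3 [d3 [b3 [nb3 pb3 ->]]].
  have p3 : perm_eq (letters u' ++ letters b3) ((letters u' ++ letters b') ++ letters b).
    by rewrite -catA perm_cat2l.
  have vv3 : (v < v3)%N.
    apply: (nf_min_gt nb3) => t; rewrite (perm_mem pb3) /= mem_cat => /orP[tb|tb].
      exact: leq_trans vw' ((nf_min nb').2 _ tb).
    exact: leq_trans vw ((nf_min nb).2 _ tb).
  have [|||z3 [nz3 pz3 kz3 _ Dz3]] := IHk u' b3 v3 d3 nu' nb3 vv3.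
  - by [].
  - by rewrite (perm_uniq p3).
  - by rewrite (perm_size p3).
  rewrite -[br _ _ _](subrK (im z3)); apply: lin_spanD; last first.
    by apply: lin_span_mem; exists z3; split=> //; apply: perm_trans p3.
  apply: lin_span_sub Dz3 => y [u4 [nu4 pu4 ku4 ->]]; exists u4; split=> //.
    exact: perm_trans p3.
  exact: leqW.
- by move: sN; rewrite /= !size_cat; lia.
Qed.

Lemma nf_red_bracket v u b : nf v true u -> {in letters b, forall x : 'I_n, (v < x)%N} ->
  uniq (letters u ++ letters b) -> (size (letters u ++ letters b) <= N)%N ->
  lin_span [set x | exists u', [/\ nf v true u',
    perm_eq (letters u') (letters u ++ letters b) & x = im u']]%classic
    (br Red (im u) (im b)).
Proof.
move=> nu vb ub sN.
have szu : (0 < size (letters u))%N by case: (letters u) (gr_letters u).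
have ubb : uniq (letters b) by move: ub; rewrite cat_uniq => /and3P[].
apply: (lin_span_map (f := fun x => br Red (im u) x)) (IHN _ ubb) => [a x y|x|].
- exact: brLr.
- case=> w [d [b' [nb' pb' ->]]].
  have p : perm_eq (letters u ++ letters b') (letters u ++ letters b) by rewrite perm_cat2l.
  have vw : (v < w)%N by apply: (nf_min_gt nb') => y; rewrite (perm_mem pb'); apply: vb.
  have [||z [nz pz _ _ Dz]] := nf_red_insert nu nb' vw (leqnn _).
  - by rewrite (perm_uniq p).
  - by rewrite (perm_size p).
  rewrite -[br _ _ _](subrK (im z)); apply: lin_spanD; last first.
    by apply: lin_span_mem; exists z; split=> //; apply: perm_trans p.
  apply: lin_span_sub Dz => y [u4 [nu4 pu4 _ ->]]; exists u4; split=> //.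
  exact: perm_trans p.
- by move: sN; rewrite size_cat; lia.
Qed.

(** [u] is the block collected around [v] so far, and [q] is the context still to be processed; [v]
    occurs in both, hence [v :: L]. A red bracket at [v] is absorbed into [u]. A blue one is
    distributed over the letters of its other side, up to red terms with a smaller context. *)
Lemma nf_span_plug k v u q L : (size (letters q) <= k)%N ->
  nf v true u -> v \in letters q -> uniq (letters q) ->
  {in letters q, forall x : 'I_n, (v <= x)%N} ->
  perm_eq (v :: L) (letters u ++ letters q) -> uniq L -> (size L <= N)%N ->
  lin_span (nf_images L) (plug v (im u) q).
Proof.
elim: k u q L => [|k IHk] u q L kq nu vq uq vmin pL uL sN.
  by case: (letters q) vq kq.
case: (innermost_bracket R uq vq) => [qv|[c [b [q' [a [vq' pq E]]]]]].
  rewrite qv in pL *; rewrite /plug /= eqxx; apply: lin_span_mem; exists v, true, u; split=> //.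
  by move: pL; rewrite perm_sym /= perm_catC /= perm_cons.
rewrite E; apply: lin_spanZ.
have uqb : uniq (letters q' ++ letters b) by rewrite -(perm_uniq pq).
have uq' : uniq (letters q') by move: uqb; rewrite cat_uniq => /and3P[].
have ub : uniq (letters b) by move: uqb; rewrite cat_uniq => /and3P[].
have nob x : x \in letters q' -> x \in letters b -> False.
  by move: uqb; rewrite cat_uniq => /and3P[_ /hasPn no _] xq /no; rewrite /= xq.
have vb : {in letters b, forall x : 'I_n, (v < x)%N}.
  move=> x xb; rewrite ltn_neqAle vmin ?(perm_mem pq) ?mem_cat ?xb ?orbT // andbT.
  by apply/eqP => /val_inj vx; apply: (nob v); rewrite // vx.
have vmin' : {in letters q', forall x : 'I_n, (v <= x)%N}.
  by move=> x xq; apply: vmin; rewrite (perm_mem pq) mem_cat xq.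
have vnb : v \notin letters b by apply/negP => /vb; rewrite ltnn.
have sq : size (letters q) = (size (letters q') + size (letters b))%N.
  by rewrite -size_cat; exact: perm_size.
have szu : (0 < size (letters u))%N by case: (letters u) (gr_letters u).
have szb m : (0 < size (letters m))%N by case: (letters m) (gr_letters m).
(* This shape covers a red bracket at [v] as well as the error terms of a blue one. *)
have red b1 q1 : (size (letters q1) <= k)%N -> v \in letters q1 -> uniq (letters q1) ->
    {in letters q1, forall x : 'I_n, (v <= x)%N} ->
    {in letters b1, forall x : 'I_n, (v < x)%N} ->
    perm_eq (v :: L) (letters u ++ letters q1 ++ letters b1) ->
    lin_span (nf_images L) (plug v (br Red (im u) (im b1)) q1).
  move=> kq1 vq1 uq1 vmin1 vb1 p1.
  have pv := perm_to_rem vq1.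
  have pL1 : perm_eq L ((letters u ++ letters b1) ++ rem v (letters q1)).
    rewrite -(perm_cons v) (permPl p1); apply/permP => P.
    by have := permP pv P; rewrite /= !count_cat /=; clear; lia.
  have uub : uniq (letters u ++ letters b1).
    by move: uL; rewrite (perm_uniq pL1) cat_uniq => /and3P[].
  have := perm_size pL1; rewrite size_cat => sL1.
  apply: (lin_span_map (f := fun x => plug v x q1)) (nf_red_bracket nu vb1 uub _) => [a' x y|x|].
  - exact: plug_linear.
  - case=> u1 [nu1 pu1 ->]; apply: IHk => //.
    by apply/permP => P; move: (permP p1 P) (permP pu1 P); rewrite /= !count_cat; clear; lia.
  - by rewrite sL1 in sN; exact: leq_trans (leq_addr _ _) sN.
case: c E => E.
  apply: red => //; first by move: (szb b) kq sq; clear; lia.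
  by apply: perm_trans pL _; rewrite perm_cat2l.
have := blue_derivation (im u) vnb ub.
set s := \sum_(p <- _) _ => D.
have -> : plug v (br Blue (im u) (im b)) q' =
    plug v (br Blue (im u) (im b) - s) q' + plug v s q'.
  by have := plug_linear 1 (br Blue (im u) (im b) - s) s uq' vq'; rewrite !scale1r subrK.
apply: lin_spanD.
  apply: (lin_span_map (f := fun x => plug v x q')) D => [a' x y|x0].
    exact: plug_linear.
  case=> b1 [q1 [vq1 pq1 ->]]; rewrite plug_plug; last by right.
  have ub1 : uniq (letters b1 ++ letters q1) by rewrite -(perm_uniq pq1) /= vnb.
  have ps := perm_letters_subst q1 uq' vq'.
  have szs : (size (letters (subst v q1 q'))).+1 = (size (letters q1) + size (letters q'))%N.
    by rewrite -size_cat; exact: (perm_size ps).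
  have szp : (size (letters b)).+1 = (size (letters b1) + size (letters q1))%N.
    by rewrite -size_cat; exact: (perm_size pq1).
  have uq1 : uniq (letters q1) by move: ub1; rewrite cat_uniq => /and3P[].
  have q1b x : x \in letters q1 -> x = v \/ x \in letters b.
    move=> xq1; have : x \in letters b1 ++ letters q1 by rewrite mem_cat xq1 orbT.
    by rewrite -(perm_mem pq1) inE => /orP[/eqP|]; auto.
  have prem := perm_to_rem vq'.
  have ps' : perm_eq (letters (subst v q1 q')) (letters q1 ++ rem v (letters q')).
    rewrite -(perm_cons v) (permPl ps); apply/permP => P.
    by have := permP prem P; rewrite /= !count_cat /=; clear; lia.
  apply: red.
  - by move: (szb b1) szs szp sq kq; clear; lia.
  - exact: subst_letters_sup.
  - rewrite (perm_uniq ps') cat_uniq uq1 rem_uniq //= andbT.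
    apply/hasPn => x; rewrite mem_rem_uniq // !inE => /andP[xv xq'] /=.
    apply/negP => /q1b[/eqP|xb]; first by rewrite (negPf xv).
    exact: nob xq' xb.
  - move=> x /subst_letters_sub[/q1b[->//|/vb/ltnW//]|]; exact: vmin'.
  - move=> x xb1; have : x \in letters b1 ++ letters q1 by rewrite mem_cat xb1.
    rewrite -(perm_mem pq1) inE => /orP[/eqP xv|/vb//].
    by move: ub1; rewrite cat_uniq => /and3P[_ /hasPn/(_ _ vq1)/=]; rewrite -xv xb1.
  - apply/permP => P; move: (permP pL P) (permP pq P) (permP pq1 P) (permP ps P).
    by rewrite /= !count_cat /=; clear; lia.
(* The remaining terms are [T] with one letter [p] of [b] replaced by <u, p>. As [T] contains no
   letter of [u], the hypothesis [IHN] expands it into normal forms. *)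
pose T := subst v b q'.
have pT := perm_letters_subst b uq' vq'; rewrite -/T in pT.
have pLT : perm_eq L (letters u ++ letters T).
  rewrite -(perm_cons v); apply/permP => P; move: (permP pL P) (permP pq P) (permP pT P).
  by rewrite /= !count_cat /=; clear; lia.
have uLT : uniq (letters u ++ letters T) by rewrite -(perm_uniq pLT).
have uT : uniq (letters T) by move: uLT; rewrite cat_uniq => /and3P[].
have vu : v \in letters u by case: (nf_min nu).
have vT : {in letters T, forall x : 'I_n, (v < x)%N}.
  move=> x xT; rewrite ltn_neqAle; apply/andP; split.
    apply/eqP => /val_inj vx; move: uLT; rewrite cat_uniq => /and3P[_ /hasPn/(_ _ xT)/= + _].
    by rewrite -vx vu.
  by case: (subst_letters_sub xT) => [/vb/ltnW|/vmin'].
have -> : plug v s q' = \sum_(p <- letters b) plug p (br Blue (im u) (lie2_gen R p)) T.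
  have plug0 : plug v (0 : lie2 R n) q' = 0.
    have := plug_linear (1 : R) 0 0 uq' vq'; rewrite !scale1r add0r.
    by move/(congr1 (fun z => z - plug v (0 : lie2 R n) q')); rewrite addrK subrr => <-.
  have sumE (r : seq 'I_n) (F : 'I_n -> lie2 R n) :
      plug v (\sum_(p <- r) F p) q' = \sum_(p <- r) plug v (F p) q'.
    elim: r => [|p r IH]; first by rewrite !big_nil plug0.
    have := plug_linear 1 (F p) (\sum_(j <- r) F j) uq' vq'.
    by rewrite !big_cons !scale1r IH.
  rewrite sumE; apply: eq_big_seq => p pb; rewrite plug_plug //.
  by left; apply/negP => /nob/(_ pb).
have bT p : p \in letters b -> p \in letters T by move=> pb; apply: subst_letters_sup.
have : {subset letters b <= letters T} by move=> p; apply: bT.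
elim: (letters b) => [|p r IHr] sub; first by rewrite big_nil; apply: lin_span0.
rewrite big_cons; apply: lin_spanD; last first.
  by apply: IHr => x xr; apply: sub; rewrite inE xr orbT.
have pTm : p \in letters T by apply: sub; rewrite mem_head.
(* The substitution extends to a linear map on the whole algebra, so it applies to the expansion of
   [T] term by term. *)
have [f [flin fim]] := plug_endomorphism p (br Blue (im u) (lie2_gen R p)).
rewrite -fim; apply: lin_span_map flin _ (IHN _ uT) => [x|]; last first.
  by apply: leq_trans sN; rewrite (perm_size pLT) size_cat -[X in (X < _)%N]add0n ltn_add2r.
case=> w [d [o [no po ->]]]; rewrite fim; apply: lin_span_mem.
exists v, false, (subst p (Br Blue u (Leaf p)) o).
have po' : p \in letters o by rewrite (perm_mem po).
have uo : uniq (letters o) by rewrite (perm_uniq po).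
split.
- by apply: (nf_blue nu no _ po'); apply: (nf_min_gt no) => t; rewrite (perm_mem po); apply: vT.
- rewrite -(perm_cons p); have ps := perm_letters_subst (Br Blue u (Leaf p)) uo po'.
  apply/permP => P; move: (permP ps P) (permP pLT P) (permP po P).
  by rewrite /= !count_cat /=; clear; lia.
- by rewrite image_subst /plug.
Qed.

End InductionStep.

Lemma nf_span m : uniq (letters m) -> lin_span (nf_images (letters m)) (im m).
Proof.
have [N] := ubnP (size (letters m)); elim: N m => // N IHN m; rewrite ltnS => sN um.
have IH m' : (size (letters m') < N)%N -> uniq (letters m') ->
    lin_span (nf_images (letters m')) (im m') by move=> ?; apply: IHN.
pose v := [arg min_(x < gr m in letters m) (x : nat)]%N.
have [vm vmin] : v \in letters m /\ {in letters m, forall x : 'I_n, (v <= x)%N}.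
  by rewrite /v; case: arg_minnP => [|v' v'm v'min]; rewrite ?gr_letters.
(* Start with the whole of [m] as context and the trivial block [v]. *)
have := nf_span_plug IH (leqnn _) (nf_leaf v) vm um vmin (perm_refl _) um sN.
suff -> : plug v (im (Leaf v)) m = im m by [].
have id m' : plug v (im (Leaf v)) m' = im m'.
  elim: m' => [i|c m1 IH1 m2 IH2] /=; last by rewrite plugB IH1 IH2.
  by rewrite /plug /=; case: eqP => // ->.
exact: id.
Qed.

End NormalForms.

(** * Recovering a normal form from its graph *)

Section NormalFormGraph.
Variable n : nat.
Implicit Types (m u b o : monomial n) (v w p : 'I_n).

Lemma nf_gr v u : nf v true u -> gr u = v.
Proof.
elim: u => [i|c u IHu b _] nu; case: (nf_true_inv nu) => [[->]//|[w [d [u' [b' [//]]]]]].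
case=> -> <- <- nu' nb vw _; rewrite gr_Br (IHu nu') /link_color.
by rewrite (leq_trans vw) // (nf_min nb).2 // gr_letters.
Qed.

Lemma nf_red_arcs v w d u b x y : nf v true u -> nf w d b -> (v < w)%N ->
  arcs (Br Red u b) x y = [|| arcs u x y, arcs b x y | (x == v) && (y == gr b)].
Proof.
move=> nu nb vw; rewrite arcs_Br /link (nf_gr nu) /link_color.
have vg : (v < gr b)%N by rewrite (leq_trans vw) // (nf_min nb).2 // gr_letters.
by rewrite vg ltnNge (ltnW vg) /= andbT !andbF orbF.
Qed.

(** The sorting of the blocks makes the root of the last one the greatest child of [v], which
    identifies it from the arcs. *)
Lemma nf_red_child v u x : nf v true u -> arcs u v x -> (x <= last_root u)%N.
Proof.
elim: u => [i //|c u IHu b _] nu; case: (nf_true_inv nu) => [//|[w [d [u' [b' [[-> <- <-]]]]]]].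
move=> nu' nb vw lt; rewrite (nf_red_arcs _ _ nu' nb vw) => /or3P[/(IHu nu') le|ab|/andP[_ /eqP->//]].
  exact: leq_trans le (ltnW lt).
have [vb _] := arcs_letters ab.
by have := (nf_min nb).2 _ vb; rewrite leqNgt vw.
Qed.

Lemma subst_blue_gr v u p o : gr u = v -> (v < p)%N ->
  gr (subst p (Br Blue u (Leaf p)) o) = gr o.
Proof.
move=> gu vp; elim: o => [i|c o1 IH1 o2 IH2]; last by rewrite [subst _ _ _]/= !gr_Br IH1 IH2.
rewrite [subst _ _ _]/=; case: eqP => [->|//]; rewrite gr_Br gu /link_color /=.
by rewrite vp.
Qed.

Lemma subst_blue_arcs v u p o x y : gr u = v -> (v < p)%N -> p \in letters o ->
  arcs (subst p (Br Blue u (Leaf p)) o) x y =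
  [|| arcs o x y, arcs u x y | (x == p) && (y == v)].
Proof.
move=> gu vp po; transitivity (arcs o x y ||
  (p \in letters o) && (arcs u x y || (x == p) && (y == v))); last by rewrite po.
elim: o {po} => [i|c o1 IH1 o2 IH2]; rewrite [subst _ _ _]/=.
  rewrite inE eq_sym; case: eqP => // _; rewrite arcs_Br /= /link gu /link_color /=.
  by rewrite vp ltnNge (ltnW vp) /= andbT !andbF.
rewrite !arcs_Br IH1 IH2 !(subst_blue_gr _ gu vp) /= mem_cat.
case: (arcs o1 x y); case: (arcs o2 x y); case: (link _ _ _ x y) => //=;
  by rewrite ?orbT // ?orbF; case: (p \in letters o1); case: (p \in letters o2);
     rewrite /= ?orbb ?orbF ?orbT.
Qed.

Lemma subst_blue_letters u p o :
  uniq (letters (subst p (Br Blue u (Leaf p)) o)) -> p \in letters o ->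
  uniq (letters o) /\
  perm_eq (letters (subst p (Br Blue u (Leaf p)) o)) (letters u ++ letters o).
Proof.
set t := Br Blue u (Leaf p); move=> us po.
have uo : uniq (letters o).
  have sup q x : x \in letters q -> x \in letters (subst p t q).
    elim: q => [i|c q1 IH1 q2 IH2] /=.
      by rewrite inE => /eqP->; case: eqP => [->|_]; rewrite /= ?mem_cat inE eqxx ?orbT.
    by rewrite !mem_cat => /orP[/IH1->|/IH2->]; rewrite ?orbT.
  elim: (o) us => //= c o1 IH1 o2 IH2.
  rewrite !cat_uniq => /and3P[/IH1-> /hasPn no /IH2->]; rewrite andbT /=.
  by apply/hasPn => x /sup/no; apply: contra; apply: sup.
split=> //; rewrite -(perm_cons p); apply: perm_trans (perm_letters_subst t uo po) _.
by apply/permP => P; rewrite /= !count_cat /=; clear; lia.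
Qed.

(** A block that no arc leaves is recovered as the set of descendants of its root. *)
Lemma block_letters (e : rel 'I_n) b z : uniq (letters b) ->
  (forall x y, x \in letters b -> e x y = arcs b x y) ->
  (z \in letters b) = connect e (gr b) z.
Proof.
move=> ub eb; apply/idP/idP => [zb|].
  apply: connect_sub_rel (arcs_connect ub zb) => x y a.
  by have [xb _] := arcs_letters a; rewrite eb.
apply: (@connect_closed _ e (mem (letters b))) => [x y xb|].
  by rewrite eb // => /arcs_letters[].
exact: gr_letters.
Qed.

Lemma block_eq (e : rel 'I_n) b b' : uniq (letters b) -> uniq (letters b') ->
  (forall x y, x \in letters b -> e x y = arcs b x y) ->
  (forall x y, x \in letters b' -> e x y = arcs b' x y) ->
  gr b = gr b' -> letters b =i letters b' /\ arcs b =2 arcs b'.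
Proof.
move=> ub ub' eb eb' gg.
have L : letters b =i letters b'.
  by move=> z; rewrite (block_letters _ ub eb) gg -(block_letters _ ub' eb').
split=> // x y; case: (boolP (x \in letters b)) => xb.
  by rewrite -eb // -eb' // -L.
have xb' : x \notin letters b' by rewrite -L.
by apply/idP/idP => /arcs_letters[x' _]; [rewrite x' in xb|rewrite x' in xb'].
Qed.

(** The arcs reveal the outermost construction. In a blue form the least letter [v] has a parent,
    namely [p], and [u] consists of the descendants of [v]. In a red form [v] is the root, and the
    last block consists of the descendants of its greatest child. *)
Lemma nf_inj v d m v' d' m' : nf v d m -> nf v' d' m' ->
  uniq (letters m) -> uniq (letters m') ->
  letters m =i letters m' -> arcs m =2 arcs m' -> m = m'.
Proof.
move=> nm; elim: nm v' d' m' => {v d m} [v|v w d u b nu IHu nb IHb vw lt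
    |v w d u o p nu IHu no IHo vw po] v' d' m' nm' um um' L A.
- have vv : v' = v by have := (nf_min nm').1; rewrite -L inE => /eqP.
  case: nm' vv um' L A => {v' d' m'} [v'|v' w' d' u' b' nu' nb' vw' lt'
    |v' w' d' u' o' p' nu' no' vw' po'] vv um' L A; first by rewrite vv.
  + have := L (gr b'); rewrite /= mem_cat gr_letters orbT inE => /eqP gv.
    have := leq_trans vw' ((nf_min nb').2 _ (gr_letters b')).
    by rewrite gv vv ltnn.
  + have := L p'; rewrite subst_letters_sup //= ?mem_cat ?inE ?eqxx ?orbT // => /eqP pv.
    by have := leq_trans vw' ((nf_min no').2 _ po'); rewrite pv vv ltnn.
- have nm : nf v true (Br Red u b) by apply: nf_red nb vw lt.
  have vv : v' = v.
    apply/val_inj/eqP; rewrite eqn_leq (nf_min nm).2 ?L ?(nf_min nm').1 // andbT.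
    by rewrite (nf_min nm').2 // -L (nf_min nm).1.
  case: nm' vv um' L A => {v' d' m'} [v'|v' w' d' u' b' nu' nb' vw' lt'
    |v' w' d' u' o' p' nu' no' vw' po'] vv um' L A.
  + have := L (gr b); rewrite /= mem_cat gr_letters orbT inE => /esym/eqP gv.
    have := leq_trans vw ((nf_min nb).2 _ (gr_letters b)).
    by rewrite gv vv ltnn.
  + subst v'; have nm' : nf v true (Br Red u' b') by apply: nf_red nb' vw' lt'.
    have gg : gr b = gr b'.
      apply/val_inj/eqP; rewrite eqn_leq; apply/andP; split.
        apply: (nf_red_child nm'); rewrite -A (nf_red_arcs _ _ nu nb vw).
        by rewrite !eqxx !orbT.
      apply: (nf_red_child nm); rewrite A (nf_red_arcs _ _ nu' nb' vw').
      by rewrite !eqxx !orbT.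
    have blk u0 b0 w0 d0 : nf v true u0 -> nf w0 d0 b0 -> (v < w0)%N ->
        uniq (letters (Br Red u0 b0)) -> forall x y, x \in letters b0 ->
        arcs (Br Red u0 b0) x y = arcs b0 x y.
      move=> nu0 nb0 vw0 uu0 x y xb; rewrite (nf_red_arcs _ _ nu0 nb0 vw0).
      case: (boolP (arcs u0 x y)) => [/arcs_letters[xu _]|_].
        by have := letters_neq uu0 xu xb; rewrite eqxx.
      case: (eqVneq x v) => [xv|_]; last by rewrite orbF.
      by have := (nf_min nb0).2 _ xb; rewrite xv leqNgt vw0.
    have ures u0 b0 w0 d0 : nf v true u0 -> nf w0 d0 b0 -> (v < w0)%N ->
        uniq (letters (Br Red u0 b0)) -> forall x y,
        arcs u0 x y = arcs (Br Red u0 b0) x y && (y \in letters u0).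
      move=> nu0 nb0 vw0 uu0 x y; rewrite (nf_red_arcs _ _ nu0 nb0 vw0).
      case: (boolP (arcs u0 x y)) => [/arcs_letters[_ ->]|_] //=.
      apply/esym/negP => /andP[+ yu]; case/orP=> [/arcs_letters[_ yb]|/andP[_ /eqP yg]].
        by have := letters_neq uu0 yu yb; rewrite eqxx.
      by have := letters_neq uu0 yu (gr_letters b0); rewrite yg eqxx.
    have := um; rewrite [letters _]/= cat_uniq => /and3P[uu _ ub].
    have := um'; rewrite [letters _]/= cat_uniq => /and3P[uu' _ ub'].
    have [|Lb Ab] := block_eq ub ub' (blk _ _ _ _ nu nb vw um) _ gg.
      by move=> x y xb; rewrite A; apply: (blk _ _ _ _ nu' nb' vw' um').
    have Lu x : (x \in letters u) = (x \in letters u').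
      have lu u0 b0 : uniq (letters (Br Red u0 b0)) ->
          (x \in letters u0) = (x \in letters (Br Red u0 b0)) && (x \notin letters b0).
        move=> uu0; rewrite /= mem_cat; case: (boolP (x \in letters b0)) => xb.
          rewrite andbF; apply/negP => xu.
          by have := letters_neq uu0 xu xb; rewrite eqxx.
        by rewrite orbF andbT.
      by rewrite (lu _ _ um) (lu _ _ um') L Lb.
    rewrite (IHb _ _ _ nb') // (IHu _ _ _ nu') // => x y.
    by rewrite (ures _ _ _ _ nu nb vw um) (ures _ _ _ _ nu' nb' vw' um') A Lu.
  + subst v'; have vp : (v < p')%N := leq_trans vw' ((nf_min no').2 _ po').
    have := A p' v; rewrite (subst_blue_arcs _ _ (nf_gr nu') vp po') !eqxx !orbT.
    by rewrite -[X in arcs _ _ X](nf_gr nm) (negPf (arcs_gr _ um)).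
- have vp : (v < p)%N := leq_trans vw ((nf_min no).2 _ po).
  have nm : nf v false (subst p (Br Blue u (Leaf p)) o) by apply: nf_blue no vw po.
  have apv : arcs (subst p (Br Blue u (Leaf p)) o) p v.
    by rewrite (subst_blue_arcs _ _ (nf_gr nu) vp po) !eqxx !orbT.
  have vv : v' = v.
    apply/val_inj/eqP; rewrite eqn_leq (nf_min nm).2 ?L ?(nf_min nm').1 // andbT.
    by rewrite (nf_min nm').2 // -L (nf_min nm).1.
  case: d' nm' => nm'.
    by move: apv; rewrite A -vv -[X in arcs _ _ X](nf_gr nm') (negPf (arcs_gr _ um')).
  move Ed : false nm' => d0 nm'; case: nm' Ed vv um' L A => {v' d0 m'} [//|//|
    v' w' d' u' o' p' nu' no' vw' po'] _ vv um' L A; subst v'.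
  have vp' : (v < p')%N := leq_trans vw' ((nf_min no').2 _ po').
  have [uo pm] := subst_blue_letters um po; have [uo' pm'] := subst_blue_letters um' po'.
  have pp : p = p'.
    apply: (arcs_parent_uniq um apv); rewrite A.
    by rewrite (subst_blue_arcs _ _ (nf_gr nu') vp' po') !eqxx !orbT.
  subst p'.
  have uu1 : uniq (letters u ++ letters o) by rewrite -(perm_uniq pm).
  have uu1' : uniq (letters u' ++ letters o') by rewrite -(perm_uniq pm').
  have blk u0 o0 : nf v true u0 -> p \in letters o0 -> uniq (letters u0 ++ letters o0) ->
      forall x y, x \in letters u0 ->
      arcs (subst p (Br Blue u0 (Leaf p)) o0) x y = arcs u0 x y.
    move=> nu0 po0 uu0 x y xu; rewrite (subst_blue_arcs _ _ (nf_gr nu0) vp po0).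
    have nxo : x \notin letters o0.
      by apply/negP => xo; have := letters_neq (c := Red) uu0 xu xo; rewrite eqxx.
    case: (boolP (arcs o0 x y)) => [/arcs_letters[xo _]|_]; first by rewrite xo in nxo.
    by case: (eqVneq x p) => [xp|_]; [rewrite xp po0 in nxo|rewrite orbF].
  have ores u0 o0 : nf v true u0 -> p \in letters o0 -> uniq (letters u0 ++ letters o0) ->
      forall x y, arcs o0 x y =
      [&& arcs (subst p (Br Blue u0 (Leaf p)) o0) x y, x \in letters o0 & y \in letters o0].
    move=> nu0 po0 uu0 x y; rewrite (subst_blue_arcs _ _ (nf_gr nu0) vp po0).
    case: (boolP (arcs o0 x y)) => [/arcs_letters[-> ->]|_] //=.
    apply/esym/negP => /and3P[+ xo yo]; case/orP=> [/arcs_letters[xu _]|/andP[_ /eqP yv]].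
      by have := letters_neq (c := Red) uu0 xu xo; rewrite eqxx.
    have vu : v \in letters u0 by case: (nf_min nu0).
    by have := letters_neq (c := Red) uu0 vu yo; rewrite yv eqxx.
  have uu : uniq (letters u) by move: uu1; rewrite cat_uniq => /and3P[].
  have uu' : uniq (letters u') by move: uu1'; rewrite cat_uniq => /and3P[].
  have [||Lu Au] := block_eq uu uu' (blk _ _ nu po uu1) _.
  - by move=> x y xu; rewrite A; apply: blk.
  - by rewrite (nf_gr nu) (nf_gr nu').
  have Lo x : (x \in letters o) = (x \in letters o').
    have lo u0 o0 : uniq (letters u0 ++ letters o0) ->
        (x \in letters o0) = (x \in letters u0 ++ letters o0) && (x \notin letters u0).
      move=> uu0; rewrite mem_cat; case: (boolP (x \in letters u0)) => xu.
        rewrite andbF; apply/negP => xo.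
        by have := letters_neq (c := Red) uu0 xu xo; rewrite eqxx.
      by rewrite andbT.
    by rewrite (lo _ _ uu1) (lo _ _ uu1') -(perm_mem pm) -(perm_mem pm') L Lu.
  rewrite (IHu _ _ _ nu') // (IHo _ _ _ no') // => x y.
  by rewrite (ores _ _ nu po uu1) (ores _ _ nu' po' uu1') A !Lo.
Qed.

End NormalFormGraph.

(** * The basis theorem *)

Section UnitriangularSystems.
Variables (R : comPzRingType) (I : eqType) (s : seq I) (P : I -> I -> R) (rk : I -> nat).
Local Open Scope ring_scope.
Hypothesis us : uniq s.
Hypothesis P_diag : {in s, forall i, P i i * P i i = 1}.
Hypothesis P_tri : {in s &, forall i j, i <> j -> P i j <> 0 -> (rk j < rk i)%N}.

Lemma unitriangular_inj (c : I -> R) :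
  {in s, forall i, \sum_(j <- s) c j * P i j = 0} -> {in s, forall i, c i = 0}.
Proof.
move=> eqs i; have [k] := ubnP (rk i); elim: k i => // k IHk i; rewrite ltnS => ki si.
have := eqs i si; rewrite (bigD1_seq i) //= big_seq_cond big1 ?addr0.
  by move/(congr1 (fun x => x * P i i)); rewrite -mulrA P_diag // mulr1 mul0r.
move=> j /andP[sj ji]; have [->|nP] := EM (P i j = 0); first by rewrite mulr0.
rewrite IHk ?mul0r //; apply: leq_trans ki; apply: P_tri => // ij.
by rewrite ij eqxx in ji.
Qed.

(** Rows are solved by increasing rank: a correction in the columns of rank [k] changes no row of
    smaller rank, and in a row of rank [k] only its diagonal entry, which is its own inverse. *)
Lemma unitriangular_surj (y : I -> R) (N : nat) : (forall i, rk i < N)%N ->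
  exists c : I -> R, {in s, forall i, \sum_(j <- s) c j * P i j = y i}.
Proof.
move=> rkN.
have H k : exists c : I -> R,
    {in s, forall i, (rk i < k)%N -> \sum_(j <- s) c j * P i j = y i}.
  elim: k => [|k [c cP]]; first by exists (fun=> 0) => i.
  pose r i := y i - \sum_(j <- s) c j * P i j.
  exists (fun j => c j + (if rk j == k then r j * P j j else 0)) => i si.
  under eq_bigr do rewrite mulrDl.
  rewrite big_split /= ltnS leq_eqVlt => /orP[/eqP rki|rki].
    rewrite [X in _ + X](bigD1_seq i) //= rki eqxx [X in _ + (_ + X)]big_seq_cond [X in _ + (_ + X)]big1 ?addr0.
      by rewrite -mulrA P_diag // mulr1 [LHS]addrC subrK.
    move=> j /andP[sj ji]; case: eqP => rkj; last by rewrite mul0r.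
    have [->|nP] := EM (P i j = 0); first by rewrite mulr0.
    have : (rk j < rk i)%N by apply: P_tri => // ij; rewrite ij eqxx in ji.
    by rewrite rki rkj ltnn.
  rewrite [X in _ + X]big_seq_cond [X in _ + X]big1 ?addr0 ?cP // => j /andP[sj _].
  case: eqP => rkj; last by rewrite mul0r.
  have [->|nP] := EM (P i j = 0); first by rewrite mulr0.
  have : (rk j < rk i)%N by apply: P_tri => // ij; move: rki; rewrite ij rkj ltnn.
  by rewrite rkj ltnNge (ltnW rki).
by have [c cP] := H N; exists c => i si; apply: cP.
Qed.

End UnitriangularSystems.

(** * Bases from sections of the graph map *)

Section Basis.
Variables (R : comPzRingType) (n : nat).
Local Open Scope ring_scope.
Implicit Types (m : monomial n) (g : cgraph n).
Local Notation im := (@monomial_image R n).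

Definition garcs g : rel 'I_n := fun x y =>
  (x != y) && (([set x; y]%SET, link_color x y) \in g).

Definition graph_key g : seq nat := key (garcs g) (enum 'I_n).

(** Counting the graphs with a smaller key turns the lexicographic order into a bounded numerical
    rank. *)
Definition graph_rank g : nat :=
  #|[set h : cgraph n | lexlt (graph_key h) (graph_key g)]%SET|.

Lemma graph_rank_lt g h : lexlt (graph_key g) (graph_key h) ->
  (graph_rank g < graph_rank h)%N.
Proof.
move=> gh; apply: proper_card; apply/properP; split.
  by apply/fintype.subsetP => k; rewrite !inE => /lexlt_trans; apply.
by exists g; rewrite !inE ?lexlt_irr.
Qed.

Lemma graph_rank_bound g : (graph_rank g < #|{: cgraph n}|.+1)%N.
Proof. by rewrite ltnS max_card. Qed.

Lemma multilinear_uniq m : multilinear_monomials n m -> uniq (letters m).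
Proof. by move=> mm; rewrite (perm_uniq mm) enum_uniq. Qed.

Lemma garcs_graph m : uniq (letters m) -> garcs (graph m) = arcs m.
Proof.
move=> um; apply/funext => x; apply/funext => y.
by rewrite graph_arcsE.
Qed.

(** The forest with the single member [m'] satisfies the premises of [forest_key]: a nonzero pairing
    gives compatibility, and no arc can leave [m']. *)
Lemma pairing_triangular m m' :
  multilinear_monomials n m -> multilinear_monomials n m' ->
  pairing R (garcs (graph m)) m' <> 0 ->
  graph m' = graph m \/ (graph_rank (graph m') < graph_rank (graph m))%N.
Proof.
move=> mm mm'; have um := multilinear_uniq mm; have um' := multilinear_uniq mm'.
rewrite garcs_graph // => pne.
have e_parent x y z := arcs_parent_uniq (x := x) (y := y) (z := z) um.
have [f e_rank] := arcs_rank um.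
have [r cr] := pairing_compat e_parent um' pne.
have fE : farcs [:: m'] =2 arcs m' by move=> x y; rewrite /farcs /= orbF.
have inl x : x \in letters m' by rewrite (perm_mem mm') mem_enum.
have srt : sorted (fun x y : 'I_n => x < y)%N (enum 'I_n).
  by have := iota_ltn_sorted 0 n; rewrite -val_enum_ord sorted_map.
have [|||agr|lt] := @forest_key n (arcs m) f (enum 'I_n) [:: m'] e_parent e_rank srt.
- by rewrite /fletters /= cats0.
- by move=> m0; rewrite inE => /eqP->; exists r.
- by move=> x y _ _ _; exists m'; rewrite ?mem_head ?inl.
- left; apply: eq_arcs_graph => // x y.
  by rewrite -fE agr ?mem_enum.
- right; apply: graph_rank_lt; rewrite /graph_key !garcs_graph //.
  by rewrite -(eq_key (e := farcs [:: m'])) // => x y _ _; rewrite fE.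
Qed.

Lemma pairing_graph_diag m : multilinear_monomials n m ->
  pairing R (garcs (graph m)) m * pairing R (garcs (graph m)) m = 1.
Proof.
move=> /multilinear_uniq um; apply: pairing_diag => // x y _ _.
by rewrite garcs_graph.
Qed.

Lemma linear0 (F : lie2 R n -> R) :
  (forall a u v, F (a *: u + v) = a * F u + F v) -> F 0 = 0.
Proof.
move=> Flin; apply: (addrI (F 0)); rewrite addr0.
by have := Flin 1 0 0; rewrite scale1r mul1r addr0 => <-.
Qed.

Lemma linear_sum (F : lie2 R n -> R) (I : Type) (s : seq I) (c : I -> R) (x : I -> lie2 R n) :
  (forall a u v, F (a *: u + v) = a * F u + F v) ->
  F (\sum_(i <- s) c i *: x i) = \sum_(i <- s) c i * F (x i).
Proof.
move=> Flin; elim: s => [|i s IH]; last by rewrite !big_cons Flin IH.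
by rewrite !big_nil linear0.
Qed.

Section Sections.
Variable gs : seq (cgraph n).
Hypothesis ugs : uniq gs.
Hypothesis gsP : forall g, g \in gs <-> exists2 m, multilinear_monomials n m & graph m = g.

Definition graph_section (sigma : cgraph n -> monomial n) : Prop :=
  {in gs, forall g, multilinear_monomials n (sigma g) /\ graph (sigma g) = g}.

Lemma section_diag sigma : graph_section sigma -> {in gs, forall g,
  pairing R (garcs g) (sigma g) * pairing R (garcs g) (sigma g) = 1}.
Proof. by move=> sg g /sg[mm gE]; have := pairing_graph_diag mm; rewrite gE. Qed.

Lemma section_tri sigma : graph_section sigma -> {in gs &, forall g h, g <> h ->
  pairing R (garcs g) (sigma h) <> 0 -> (graph_rank h < graph_rank g)%N}.
Proof.
move=> sg g h /sg[mg gE] /sg[mh hE] ngh.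
rewrite -[in garcs _]gE => /(pairing_triangular mg mh).
by rewrite gE hE => -[] // /esym.
Qed.

(** It is not established beforehand that every graph comes from a normal form, so [tau] falls back
    on [sigma] where there is none. By [nf_inj] every multilinear normal form is a value of
    [tau]. *)
Lemma nf_section sigma : graph_section sigma -> exists2 tau, graph_section tau &
  forall m, multilinear_monomials n m ->
  exists d : cgraph n -> R, im m = \sum_(g <- gs) d g *: im (tau g).
Proof.
move=> sg.
have [tau tauP] : exists tau : cgraph n -> monomial n, forall g, g \in gs ->
    [/\ multilinear_monomials n (tau g), graph (tau g) = g
    & forall v d m, nf v d m -> multilinear_monomials n m -> graph m = g -> tau g = m].
  suff /choice[tau tauP] : forall g, exists t, g \in gs ->
    [/\ multilinear_monomials n t, graph t = g
    & forall v d m, nf v d m -> multilinear_monomials n m -> graph m = g -> t = m].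
    by exists tau.
  move=> g; have [[v [d [t [nt mt gt]]]]|no] :=
    EM (exists v d t, [/\ nf v d t, multilinear_monomials n t & graph t = g]).
    exists t => _; split=> // v' d' m nm mm gm.
    have [ut um] := (multilinear_uniq mt, multilinear_uniq mm).
    apply: (nf_inj nt nm) => //.
      by move=> x; rewrite (perm_mem mt) (perm_mem mm).
    by apply: eq_graph_arcs; rewrite // gt gm.
  exists (sigma g) => gi; have [ms gsE] := sg g gi; split=> // v d m nm mm gm.
  by case: no; exists v, d, m.
exists tau => [g /tauP[]//|m mm].
move: (im m) (nf_span R (multilinear_uniq mm)).
apply: lin_span_ind => [|a x w [v [d [m' [nm' pm' ->]]]] [c ->]].
  by exists (fun=> 0); rewrite big1 // => g _; rewrite scale0r.
have mm' : multilinear_monomials n m' by apply: perm_trans mm.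
have gi : graph m' \in gs by apply/gsP; exists m'.
exists (fun g => (if g == graph m' then a else 0) + c g).
under [RHS]eq_bigr do rewrite scalerDl.
rewrite big_split /= [X in _ = X + _](bigD1_seq (graph m')) //= eqxx [X in _ + X + _]big1 ?addr0.
  by have [_ _ /(_ _ _ _ nm' mm' erefl)->] := tauP _ gi.
by move=> g /negPf->; rewrite scale0r.
Qed.

Lemma section_span sigma m : graph_section sigma -> multilinear_monomials n m ->
  exists c : cgraph n -> R, im m = \sum_(g <- gs) c g *: im (sigma g).
Proof.
move=> sg mm; have [tau tg tspan] := nf_section sg.
have /choice[F FP] : forall g, exists F : lie2 R n -> R,
    (forall a u v, F (a *: u + v) = a * F u + F v) /\
    forall m, multilinear_monomials n m -> F (im m) = pairing R (garcs g) m.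
  by move=> g; apply: pairing_functional.
(* [c] is chosen so that every functional takes the same value on [im m] and on the combination of
   the [sigma g]. *)
have [c cP] := unitriangular_surj ugs (section_diag sg) (section_tri sg)
  (fun g => F g (im m)) graph_rank_bound.
exists c; apply/eqP; rewrite -subr_eq0.
have [b0 b0P] := tspan m mm.
have /choice[b bP] : forall h, exists d : cgraph n -> R,
    h \in gs -> im (sigma h) = \sum_(g <- gs) d g *: im (tau g).
  move=> h; case: (boolP (h \in gs)) => hi; last by exists (fun=> 0).
  by have [d dP] := tspan _ (sg h hi).1; exists d.
(* The coefficients of the difference along [tau]. *)
pose d g := b0 g - \sum_(h <- gs) c h * b h g.
have xE : im m - \sum_(g <- gs) c g *: im (sigma g) = \sum_(g <- gs) d g *: im (tau g).
  rewrite {1}b0P [X in _ - X = _](eq_big_seq (fun h => \sum_(g <- gs) (c h * b h g) *: im (tau g))); last first.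
    move=> h hi; rewrite bP // scaler_sumr.
    by apply: eq_bigr => g _; rewrite scalerA.
  rewrite exchange_big /= -sumrB; apply: eq_bigr => g _.
  by rewrite -scaler_suml -scalerBl.
rewrite xE big_seq big1 // => g gi.
rewrite (unitriangular_inj ugs (section_diag tg) (section_tri tg)) ?scale0r // => h hi.
have [Flin Fim] := FP h.
have -> : \sum_(j <- gs) d j * pairing R (garcs h) (tau j) =
    F h (\sum_(j <- gs) d j *: im (tau j)).
  rewrite linear_sum //; apply: eq_big_seq => j ji.
  by rewrite Fim //; case: (tg j ji).
rewrite -xE addrC -scaleN1r Flin linear_sum // mulN1r -(cP h hi) addrC.
by rewrite -sumrB big_seq big1 // => j ji; rewrite Fim ?subrr //; case: (sg j ji).
Qed.

End Sections.

Lemma section_free (S : set (monomial n)) :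
  (forall m, S m -> multilinear_monomials n m) ->
  (forall m m', S m -> S m' -> graph m = graph m' -> m = m') ->
  lin_free S im.
Proof.
move=> Sm Sinj s c us sS sum0.
apply: (unitriangular_inj (P := fun m m' => pairing R (garcs (graph m)) m')
  (rk := fun m => graph_rank (graph m)) us) => [m /sS/Sm/pairing_graph_diag //|m m' ms ms' ne pne|m ms].
  have [/Sinj E|//] := pairing_triangular (Sm _ (sS _ ms)) (Sm _ (sS _ ms')) pne.
  by case: ne; rewrite E //; apply: sS.
have [F [Flin Fim]] := pairing_functional R (garcs (graph m)).
transitivity (F (\sum_(i <- s) c i *: im i)).
  by rewrite linear_sum //; apply: eq_big_seq => i /sS/Sm mi; rewrite Fim.
by rewrite sum0 linear0.
Qed.

End Basis.

Theorem theorem8p6 (R : comPzRingType) (n : nat) (S : set (monomial n)) :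
  (S `<=` multilinear_monomials n)%classic ->
  set_bij S (Gbar n) (@graph n) ->
  is_basis (Lie2 R n) S (@monomial_image R n).
Proof.
move=> Sm [_ Sinj Ssurj]; split.
  by apply: section_free => // m m' mS mS'; apply: Sinj; rewrite inE.
apply/seteqP; split=> x.
  by apply: lin_span_sub => _ [m mS <-]; exists m => //; apply: Sm.
apply: (lin_span_map (f := id)) => // _ [m mm <-].
pose gs := [seq g <- enum {: cgraph n} |
  `[< exists2 m, multilinear_monomials n m & graph m = g >]].
have ugs : uniq gs by rewrite filter_uniq ?enum_uniq.
have gsP g : g \in gs <-> exists2 m, multilinear_monomials n m & graph m = g.
  by rewrite mem_filter mem_enum andbT; split=> /asboolP.
have [sigma sigmaP] : exists sigma : cgraph n -> monomial n,
    {in gs, forall g, S (sigma g) /\ graph (sigma g) = g}.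
  suff /choice[sigma sigmaP] : forall g, exists t, g \in gs -> S t /\ graph t = g.
    by exists sigma.
  (* Outside [gs] any monomial will do. The given [m] serves as default, since the type of monomials
     is empty for [n = 0]. *)
  move=> g; case: (boolP (g \in gs)) => [/gsP[m' mm' <-]|_]; last by exists m.
  by have [t tS tg] := Ssurj _ (Gbar_graph mm'); exists t.
have sg : graph_section gs sigma by move=> g /sigmaP[/Sm].
have [c ->] := section_span R ugs gsP sg mm.
rewrite big_seq; elim/big_ind: _ => [||g gi].
- exact: lin_span0.
- by move=> *; apply: lin_spanD.
- by apply/lin_spanZ/lin_span_mem; exists (sigma g) => //; case: (sigmaP g gi).
Qed.
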